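(* Consider a sequence of multi-indices $\bm n=(n_1,\dots,n_r)\in\mathbb N^r$ with $|\bm n|\to\infty$, and let $\alpha_{\bm n}>-1$ be such that $$\lim_{|\bm n|\to\infty}\frac{\alpha_{\bm n}}{|\bm n|}=A\ge0,\qquad \lim_{|\bm n|\to\infty}\frac{n_i}{|\bm n|}=\theta_i>0,\quad i=1,\dots,r.$$ Let $\bm c_{\bm n}=(c_1^{(\bm n)},\dots,c_r^{(\bm n)})\in\mathbb R_{>0}^r$, with $c_i^{(\bm n)}\neq c_j^{(\bm n)}$ for $i\neq j$, be such that the limit $$\lim_{\bm n}\bm c_{\bm n}=\bm c=(c_1,\dots,c_r)\in\mathbb R_{>0}^r$$ exists, with $c_i\neq c_j$ for $i\neq j$. Then the function $y=u\,\mathcal G_\mu(u)$, where $\mathcal G_\mu$ is the Cauchy transform of the limiting distribution $\mu$ of zeros of the rescaled Type II multiple Laguerre polynomials of the second kind $\mathcal L^{(\alpha_{\bm n},\bm c_{\bm n})}_{\bm n}(|\bm n|x)$, satisfies the equation $$\frac{y+A}{y-1}\sum_{j=1}^r\frac{\theta_j}{c_ju-(y+A)}=1.$$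
   Context: $\mathbb N=\{1,2,\dots\}$, $|\bm n|=n_1+\dots+n_r$. Type II multiple Laguerre polynomial of the second kind $\mathcal L^{(\alpha,\bm c)}_{\bm n}$: the monic polynomial of degree $|\bm n|$ with $\int_0^\infty\mathcal L^{(\alpha,\bm c)}_{\bm n}(x)x^{k+\alpha}e^{-c_jx}dx=0$ for $k=0,\dots,n_j-1$, $j=1,\dots,r$. Explicitly (known), $$\mathcal L^{(\alpha,\bm c)}_{\bm n}(x)=\sum_{k_1=0}^{n_1}\cdots\sum_{k_r=0}^{n_r}(-1)^{|\bm k|}\binom{|\bm n|+\alpha}{|\bm k|}\prod_{j=1}^r\binom{n_j}{k_j}\frac{|\bm k|!}{c_1^{k_1}\cdots c_r^{k_r}}x^{|\bm n|-|\bm k|},\qquad |\bm k|=k_1+\dots+k_r.$$ For a polynomial $p$ of degree $N$ with zeros $\lambda_1,\dots,\lambda_N$ (with multiplicity), the normalized zero-counting measure is $\chi(p)=\frac1N\sum_j\delta_{\lambda_j}$; the limiting distribution of zeros $\mu$ is the weak-* limit of these measures. Cauchy transform: $\mathcal G_\mu(u)=\int\frac{d\mu(v)}{u-v}$; the equation is understood in a neighborhood of $u=\infty$. *)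

(* Defs.v *)
From HB Require Import structures.
From mathcomp Require Import all_boot all_order all_algebra.
From mathcomp Require Export complex.
From mathcomp Require Import all_classical all_reals all_analysis.

Set Implicit Arguments.
Unset Strict Implicit.
Unset Printing Implicit Defensive.

Import Order.TTheory GRing.Theory Num.Theory.
Import numFieldNormedType.Exports.

Local Open Scope classical_set_scope.
Local Open Scope ring_scope.
Local Open Scope complex_scope.

Definition msize (r : nat) (n : 'I_r -> nat) : nat := (\sum_(i < r) n i)%N.

(* The domain of integration excludes 0, where the library sets 0 `^ a = 0
   for every nonzero a. *)
Definition is_multiple_laguerre2 (R : realType) (r : nat) (alpha : R)
    (c : 'I_r -> R) (n : 'I_r -> nat) (P : {poly R}) : Prop :=
  [/\ P \is monic, size P = (msize n).+1 &
    forall (j : 'I_r) (k : nat), (k < n j)%N ->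
      (\int[lebesgue_measure]_(x in `]0%R, +oo[)
         (P.[x] * x `^ (k%:R + alpha) * expR (- c j * x))%:E = 0)%E].

(* Measures on the complex plane are measures on R * R with the product (that
   is, Borel) sigma-algebra; (a, b) stands for a + ib. *)
Definition complex_of_plane (R : realType) (z : R * R) : R[i] := z.1 +i* z.2.

Definition plane_of_complex (R : realType) (z : R[i]) : R * R :=
  (complex.Re z, complex.Im z).

(* The zeros in the complex plane, repeated according to multiplicity. *)
Definition complex_zeros (R : realType) (p : {poly R}) : seq R[i] :=
  sval (closed_field_poly_normal (map_poly (real_complex R) p)).

Definition zero_counting (R : realType) (p : {poly R}) :
    {measure set (R * R) -> \bar R} :=
  let s := complex_zeros p in
  mscale ((size s)%:R^-1)%:nng
    (msum (fun j : nat => \d_(plane_of_complex s`_j)) (size s)).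

(* Weak convergence against bounded continuous functions; since mu is a
   probability measure, this agrees with testing against C_0 or C_c. *)
Definition is_limiting_zero_distribution (R : realType) (p : nat -> {poly R})
    (mu : probability (R * R)%type R) : Prop :=
  forall f : R * R -> R, continuous f ->
    (exists M : R, forall z, `|f z| <= M) ->
    (\int[zero_counting (p m)]_z f z)%R @[m --> \oo] --> (\int[mu]_z f z)%R.

Definition cauchy_kernel (R : realType) (u : R[i]) (v : R * R) : R[i] :=
  (u - complex_of_plane v)^-1.

Definition cauchy_integrable (R : realType) (mu : probability (R * R)%type R)
    (u : R[i]) : Prop :=
  mu.-integrable setT (EFin \o (fun v => complex.Re (cauchy_kernel u v))) /\
  mu.-integrable setT (EFin \o (fun v => complex.Im (cauchy_kernel u v))).

Definition cauchy_transform (R : realType) (mu : probability (R * R)%type R)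
    (u : R[i]) : R[i] :=
  (\int[mu]_v complex.Re (cauchy_kernel u v))%R +i*
  (\int[mu]_v complex.Im (cauchy_kernel u v))%R.

(* Main.v *)
Require Import Defs.
From HB Require Import structures.
From mathcomp Require Import all_boot all_order all_algebra.
From mathcomp Require Import complex.
From mathcomp Require Import all_classical all_reals all_analysis.
From mathcomp Require Import measurable_realfun ring lra.

Set Implicit Arguments.
Unset Strict Implicit.
Unset Printing Implicit Defensive.

Import Order.TTheory GRing.Theory Num.Theory.
Import numFieldNormedType.Exports.

Local Open Scope classical_set_scope.
Local Open Scope ring_scope.
Local Open Scope complex_scope.

(* Write N = |n| and g = N + alpha. A polynomial whose integrals against
   x^(k + alpha) exp(- c x) vanish for k < n_j at c = c_j becomes, after its
   coefficients are multiplied by rising factorials, a polynomial in 1 / c with a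
   zero of order n_j at 1 / c_j. Hence L_n is obtained from 1 by N steps
   q |-> x q - a (b q + x q') with a = 1 / c_j, taken in any order. One step maps
   a polynomial with positive zeros to another, and a barrier argument bounds the
   zeros by a multiple of N.
   At a point N u off the zeros, the derivative of L_n is a sum over one-step
   deletions, which expresses the normalized Stieltjes transform G of the zeros
   exactly through those of the polynomials with one step deleted; these differ
   from G by O(1 / N). So every limit l of G along an ultrafilter satisfies
   l = sum_j theta_j / (u - A / c_j - u l / c_j), which is the claimed equation
   for y = u l and has only one small solution when |u| is large. The Stieltjes
   transforms therefore converge, hence so do all moments, and the rescaled zeros,
   which lie in a fixed interval, have a limiting distribution.
   Conversely any limiting distribution is carried by that interval, on which the
   Cauchy kernel is continuous. *)

(** * The step polynomials and their logarithmic derivatives *)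

(** Up to a falling factorial in g, the coefficients of the polynomial are those of the product of
    the X - a. This symmetry in the rates is why the steps commute, why any step can be taken as the
    last one, and why the derivative splits over deletions as for a product. A deletion keeps g and
    lowers N by 1, hence turns alpha into alpha + 1, a change that disappears after division by N.
    An exact identity and an O(1 / N) comparison thus close the equation on one unknown, without
    ratio asymptotics of neighbouring polynomials. Everything happens for |u| > 2 M0, where M0 = 2
    am (A + 4) bounds the rescaled zeros and am bounds the rates: there |N u - z| is at least N |u|
    / 2, and every denominator 1 - a (b / (N u) + ...) has modulus at least 1/2. The limit measure
    is constructed directly: the quantile functions of the zeros converge pointwise along an
    ultrafilter, and the limit pushes the uniform law of [0, 1] forward to the real axis. The stated
    form divides by y - 1. That y differs from 1 does not follow from the equation for l by mere
    rewriting and has its own argument. *)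

Section LaguerreProduct.
Variable F : fieldType.
Implicit Types (g a b x : F) (s t : seq F) (p q : {poly F}).

Definition falling g n : F := \prod_(l < n) (g - l%:R).

Lemma fallingS g n : falling g n.+1 = falling g n * (g - n%:R).
Proof. by rewrite /falling big_ord_recr. Qed.

Definition lag_step b a q : {poly F} := 'X * q - a *: (b *: q + 'X * q^`()).

(** The parameter b runs through g, g - 1, ... from the innermost step outwards; for g = |n| + alpha
    the last step has b = alpha + 1. *)
Fixpoint lagp g s : {poly F} :=
  if s is a :: s' then lag_step (g - (size s')%:R) a (lagp g s') else 1.

Definition prod_roots s : {poly F} := \prod_(a <- s) ('X - a%:P).

Lemma size_prod_roots s : size (prod_roots s) = (size s).+1.
Proof. exact: size_prod_XsubC. Qed.

(** On X^i the operator b + X d/dX acts as b + i = g - ([size s] - i), which is the next factor of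
    the falling factorial, while multiplication by X keeps the distance to the top degree. So a step
    is multiplication by X - a, seen through the factor [falling]. *)
Lemma coef_lagp g s i :
  (lagp g s)`_i = falling g (size s - i) * (prod_roots s)`_i.
Proof.
elim: s i => [|a s IH] i.
  rewrite /= /prod_roots big_nil sub0n /falling big_ord0 mul1r //.
have pE : prod_roots (a :: s) = 'X * prod_roots s - a *: prod_roots s.
  by rewrite /prod_roots big_cons mulrBl mul_polyC.
have hi k : (size s < k)%N -> (prod_roots s)`_k = 0.
  by move=> ks; rewrite nth_default// size_prod_roots.
rewrite [LHS]/= /lag_step pE !coefB !coefZ coefD coefZ !coefXM coef_deriv !IH.
case: i => [|i] /=; first by rewrite !subn0 fallingS; ring.
case: (ltnP i (size s)) => [lt_is|ge_is].
  rewrite subSS -(subnSK lt_is) fallingS natrB// -mulr_natr -natr1; ring.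
by rewrite subSS (hi i.+1) ?ltnS// !mulr0 mul0rn addr0 !mulr0 !subr0.
Qed.

Lemma lagp_perm g s1 s2 : perm_eq s1 s2 -> lagp g s1 = lagp g s2.
Proof.
move=> s12; apply/polyP => i; rewrite !coef_lagp (perm_size s12).
by rewrite /prod_roots (perm_big s2).
Qed.

Lemma deriv_prod_roots s :
  (prod_roots s)^`() = \sum_(a <- s) prod_roots (rem a s).
Proof.
elim: s => [|b s IH]; first by rewrite /prod_roots !big_nil derivC.
rewrite {1}/prod_roots big_cons derivM derivXsubC mul1r -/(prod_roots s) IH.
rewrite big_cons /= eqxx mulr_sumr; congr (_ + _); apply: eq_big_seq => a sa.
case: eqP => [->|_]; last by rewrite /prod_roots big_cons.
by rewrite [RHS](perm_big (a :: rem a s)) ?perm_to_rem// /prod_roots big_cons.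
Qed.

(** Coefficient i + 1 for s and coefficient i for a deletion lie at the same distance from the top,
    so they carry the same falling factorial and the product rule for [prod_roots] carries over. *)
Lemma deriv_lagp g s : (lagp g s)^`() = \sum_(a <- s) lagp g (rem a s).
Proof.
apply/polyP => i; rewrite coef_deriv coef_lagp coef_sum -mulrnAr -coef_deriv.
rewrite deriv_prod_roots coef_sum mulr_sumr; apply: eq_big_seq => a sa.
by rewrite coef_lagp size_rem// -subn1 -subnDA add1n.
Qed.

Lemma lagp_rem g s a : a \in s ->
  lagp g s = lag_step (g - (size s).-1%:R) a (lagp g (rem a s)).
Proof. by move=> sa; rewrite (lagp_perm g (perm_to_rem sa)) /= size_rem. Qed.

Lemma horner_prod_roots s x : (prod_roots s).[x] = \prod_(z <- s) (x - z).
Proof.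
by rewrite /prod_roots horner_prod; apply: eq_bigr => z _; rewrite hornerXsubC.
Qed.

Lemma prod_roots_neq0 s x : (forall z, z \in s -> x != z) ->
  (prod_roots s).[x] != 0.
Proof.
move=> h; rewrite horner_prod_roots prodf_seq_neq0; apply/allP => z zs /=.
by rewrite subr_eq0 h.
Qed.

(** The logarithmic derivative of [prod_roots s], that is, the unnormalized Stieltjes transform of
    the roots; [sum_inv2] is minus its derivative. *)
Definition sum_inv s x := \sum_(z <- s) (x - z)^-1.
Definition sum_inv2 s x := \sum_(z <- s) (x - z) ^- 2.

Lemma deriv_prod_rootsE s x : (forall z, z \in s -> x != z) ->
  (prod_roots s)^`().[x] = (prod_roots s).[x] * sum_inv s x.
Proof.
elim: s => [|b s IH] h.
  by rewrite /prod_roots /sum_inv !big_nil derivC hornerC mulr0.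
have hb : x - b != 0 by rewrite subr_eq0 h ?mem_head.
have hs : forall z, z \in s -> x != z by move=> z zs; rewrite h// inE zs orbT.
rewrite /prod_roots /sum_inv !big_cons derivM derivXsubC mul1r hornerD !hornerM.
rewrite -/(prod_roots s) (IH hs) hornerXsubC -/(sum_inv s x); field.
exact: hb.
Qed.

Lemma deriv2_prod_rootsE s x : (forall z, z \in s -> x != z) ->
  (prod_roots s)^`()^`().[x] =
    (prod_roots s).[x] * (sum_inv s x ^+ 2 - sum_inv2 s x).
Proof.
elim: s => [|b s IH] h.
  by rewrite /prod_roots /sum_inv /sum_inv2 !big_nil !derivC hornerC; ring.
have hb : x - b != 0 by rewrite subr_eq0 h ?mem_head.
have hs : forall z, z \in s -> x != z by move=> z zs; rewrite h// inE zs orbT.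
rewrite /prod_roots /sum_inv /sum_inv2 !big_cons derivM derivXsubC mul1r.
rewrite -/(prod_roots s) derivD derivM derivXsubC mul1r !hornerD !hornerM.
rewrite (IH hs) deriv_prod_rootsE// hornerXsubC.
rewrite -/(sum_inv s x) -/(sum_inv2 s x); field.
exact: hb.
Qed.

(* With [f = x^b q], the polynomial of [lag_step] is [x^(1-b) (f - a f')], and
   [b / x + sum_inv s x] is the logarithmic derivative of [f]. *)
Lemma lag_step_horner b a s x : x != 0 -> (forall z, z \in s -> x != z) ->
  (lag_step b a (prod_roots s)).[x] =
    (prod_roots s).[x] * (x * (1 - a * (b / x + sum_inv s x))).
Proof.
move=> x0 h; rewrite /lag_step !(hornerD, hornerN, hornerZ, hornerM, hornerX).
rewrite deriv_prod_rootsE//; field.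
exact: x0.
Qed.

(** Logarithmic derivative of the factorization in [lag_step_horner]: the three terms come from the
    factors [prod_roots s], x and 1 - a (b / x + [sum_inv s x]). The last factor is nonzero because
    x is not a root of t. *)
Lemma lag_step_log_deriv b a s t x : x != 0 ->
  (forall z, z \in s -> x != z) -> (forall z, z \in t -> x != z) ->
  prod_roots t = lag_step b a (prod_roots s) ->
  sum_inv t x = sum_inv s x + x^-1 +
    a * (b / x ^+ 2 + sum_inv2 s x) / (1 - a * (b / x + sum_inv s x)).
Proof.
move=> x0 hs ht tE.
have := lag_step_horner b a x0 hs; rewrite -tE.
have := deriv_prod_rootsE ht; rewrite {1}tE /lag_step.
rewrite !(derivB, derivZ, derivM, derivD, derivX) mul1r -polyC1.
rewrite !(hornerD, hornerN, hornerZ, hornerM, hornerX, hornerC).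
rewrite deriv2_prod_rootsE// deriv_prod_rootsE// mul1r.
have := prod_roots_neq0 ht; have := prod_roots_neq0 hs.
move: (sum_inv s x) (sum_inv t x) (sum_inv2 s x) => w v w2.
move: (prod_roots t).[x] (prod_roots s).[x] => P Q Q0 P0 e1 e2.
have d0 : 1 - a * (b / x + w) != 0.
  by apply: contra_neq P0 => d0; rewrite e2 d0 !mulr0.
have d1 : x - a * (b + x * w) != 0.
  apply: contra_neq d0 => d1; rewrite -[RHS](mulr0 x^-1) -d1; field.
  exact: x0.
rewrite e2 in e1; apply: (mulfI (mulf_neq0 Q0 (mulf_neq0 x0 d0))).
rewrite -e1; field.
by rewrite x0 [w * x]mulrC.
Qed.

End LaguerreProduct.

(** * Location of the zeros *)

Section RootLocation.
Variable R : realType.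
Implicit Types (g a b am B x : R) (s zs ts : seq R).

Lemma map_prod_roots (F G : fieldType) (f : {rmorphism F -> G}) (s : seq F) :
  map_poly f (prod_roots s) = prod_roots (map f s).
Proof.
rewrite /prod_roots rmorph_prod big_map; apply: eq_bigr => z _ /=.
by rewrite rmorphB /= map_polyX map_polyC.
Qed.

Lemma map_lag_step (F G : fieldType) (f : {rmorphism F -> G}) (b a : F)
    (q : {poly F}) :
  map_poly f (lag_step b a q) = lag_step (f b) (f a) (map_poly f q).
Proof.
rewrite /lag_step -!mul_polyC !(rmorphB, rmorphD, rmorphM) /= deriv_map.
by rewrite map_polyX !map_polyC.
Qed.

Lemma Im_inv_subr (z : R[i]) x : exists2 K : R, 0 <= K &
  complex.Im (z - x%:C)^-1 = - complex.Im z * K.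
Proof.
case: z => p q /=; exists ((p - x) ^+ 2 + q ^+ 2)^-1.
  by rewrite invr_ge0 addr_ge0// sqr_ge0.
by rewrite subr0 mulNr.
Qed.

Lemma ImD (z w : R[i]) : complex.Im (z + w) = complex.Im z + complex.Im w.
Proof. by case: z w => [? ?] [? ?]. Qed.

Lemma Im_realM x (z : R[i]) : complex.Im (x%:C * z) = x * complex.Im z.
Proof. by case: z => p q /=; rewrite mul0r addr0. Qed.

Lemma Im_sum_inv zs (z : R[i]) : exists2 K : R, 0 <= K &
  complex.Im (sum_inv (map (real_complex R) zs) z) = - complex.Im z * K.
Proof.
elim: zs => [|x zs [K K0 KE]].
  by exists 0; rewrite ?lexx// /sum_inv big_nil mulr0.
have [L L0 LE] := Im_inv_subr z x; exists (L + K); first exact: addr_ge0.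
by rewrite /sum_inv /= big_cons ImD LE -/(sum_inv _ _) KE mulrDr.
Qed.

Lemma sum_inv_map (f : {rmorphism R -> R[i]}) zs x :
  sum_inv (map f zs) (f x) = f (sum_inv zs x).
Proof.
rewrite /sum_inv big_map rmorph_sum; apply: eq_bigr => z _.
by rewrite fmorphV rmorphB.
Qed.

Lemma sum_inv_le0 zs x : all (> 0) zs -> x < 0 -> sum_inv zs x <= 0.
Proof.
move=> zs0 x0; rewrite /sum_inv; elim: zs zs0 => [|z zs IH] /=; first by rewrite big_nil.
case/andP=> z0 /IH; rewrite big_cons => h.
by rewrite -[leRHS]addr0 lerD// invr_le0 subr_le0 ltW// (lt_trans x0).
Qed.

(* Off the real axis the two terms of [b / z + sum_inv zs z] have imaginary
   parts of the sign opposite to that of [Im z]. *)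
Lemma lag_step_root_gt0 b a zs (z : R[i]) : 0 < b -> 0 < a -> all (> 0) zs ->
  root (map_poly (real_complex R) (lag_step b a (prod_roots zs))) z ->
  exists2 x, 0 < x & z = x%:C.
Proof.
move=> b0 a0 zs0 /rootP.
rewrite map_lag_step map_prod_roots => pz.
have [/mapP[x xzs ->]|zN] := boolP (z \in map (real_complex R) zs).
  by exists x => //; exact: (allP zs0).
have zNr w : w \in map (real_complex R) zs -> z != w.
  by move=> wzs; apply: contraNneq zN => ->.
have Q0 := prod_roots_neq0 zNr.
(* The factorization below divides by z, so 0 is excluded first: the value there is - a b q(0), and
   0 is not a root of q. *)
have z0 : z != 0.
  apply/eqP => z0; move: pz; rewrite z0 /lag_step.
  rewrite !(hornerD, hornerN, hornerZ, hornerM, hornerX) !mul0r addr0 add0r => /eqP.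
  rewrite z0 in Q0; rewrite oppr_eq0 mulf_eq0 mulf_eq0 !(fmorph_eq0 (real_complex R)).
  by rewrite gt_eqF// gt_eqF//=; exact/negP.
move: pz; rewrite lag_step_horner// => /eqP.
rewrite !mulf_eq0 (negbTE Q0) (negbTE z0) /= subr_eq0 => /eqP eq1.
have Im0 : complex.Im z = 0.
  have [K K0 KE] := Im_sum_inv zs z.
  have := congr1 (@complex.Im R) eq1; rewrite Im_realM ImD KE Im_realM.
  case: (z) z0 => p q /=; rewrite eq_complex /= negb_and => pq0 /esym/eqP.
  rewrite mulf_eq0 gt_eqF//= => /eqP h.
  have n0 : 0 < p ^+ 2 + q ^+ 2.
    rewrite lt_neqAle addr_ge0 ?sqr_ge0// andbT eq_sym paddr_eq0 ?sqr_ge0//.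
    by rewrite !sqrf_eq0 negb_and.
  have : q * (b / (p ^+ 2 + q ^+ 2) + K) = 0 by rewrite -[RHS]oppr0 -h; ring.
  move/eqP; rewrite mulf_eq0 => /orP[/eqP//|].
  by rewrite gt_eqF// ltr_pwDl// divr_gt0.
have zE : z = (complex.Re z)%:C by case: (z) Im0 => p q /= ->.
exists (complex.Re z) => //; move: eq1 z0; rewrite zE; set x := complex.Re z.
rewrite sum_inv_map -fmorphV -!rmorphM -rmorphD -rmorphM => /complexI eq1.
rewrite (fmorph_eq0 (real_complex R)) => x0.
rewrite lt_neqAle eq_sym x0 leNgt /=; apply/negP => xlt.
(* For x < 0 both parts of b / x + [sum_inv zs x] are nonpositive and cannot add up to 1 / a. *)
have := sum_inv_le0 zs0 xlt => h.
have hb : b / x < 0 by rewrite pmulr_rlt0// invr_lt0.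
suff : (1 : R) <= 0 by rewrite ler10.
by rewrite eq1 pmulr_rle0//; lra.
Qed.

Lemma lagp_monic g s : lagp g s \is monic /\ size (lagp g s) = (size s).+1.
Proof.
have ps := size_prod_roots s.
have c0 i : (size s < i)%N -> (lagp g s)`_i = 0.
  by move=> si; rewrite coef_lagp [(prod_roots s)`_i]nth_default ?mulr0// ps.
have c1 : (lagp g s)`_(size s) = 1.
  rewrite coef_lagp subnn /falling big_ord0 mul1r.
  have /monicP := monic_prod_XsubC s predT id.
  by rewrite lead_coefE -/(prod_roots s) ps.
have sz : size (lagp g s) = (size s).+1.
  apply/eqP; rewrite eqn_leq; apply/andP; split.
    by apply/leq_sizeP => i; exact: c0.
  rewrite ltnNge; apply/negP => h.
  by move: c1; rewrite nth_default// => /esym/eqP; rewrite oner_eq0.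
by split=> //; rewrite monicE lead_coefE sz c1.
Qed.

(** The polynomial splits over R[i]; all its roots being real, the factorization descends to R by
    injectivity of the coefficient embedding. *)
Lemma gt0_roots_split (p : {poly R}) : p \is monic ->
  (forall z : R[i], root (map_poly (real_complex R) p) z ->
     exists2 x, 0 < x & z = x%:C) ->
  exists2 zs, all (> 0) zs & p = prod_roots zs.
Proof.
move=> pm hp.
have [rs rsE] := closed_field_poly_normal (map_poly (real_complex R) p).
have lc : lead_coef (map_poly (real_complex R) p) = 1.
  by apply/eqP; rewrite -monicE map_monic.
rewrite lc scale1r in rsE.
have rs0 z : z \in rs -> exists2 x, 0 < x & z = x%:C.
  by move=> zrs; apply: hp; rewrite rsE root_prod_XsubC.
exists (map (@complex.Re R) rs).
  by apply/allP => _ /mapP[z /rs0[x x0 ->] ->].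
apply: (map_poly_inj (real_complex R)); rewrite map_prod_roots -map_comp rsE.
rewrite /prod_roots big_map; apply: eq_big_seq => z /rs0[x x0 ->] //.
Qed.

Lemma lagp_cons_roots g a s zs : 0 < g - (size s)%:R -> 0 < a ->
  all (> 0) zs -> lagp g s = prod_roots zs ->
  exists2 ts, all (> 0) ts & lagp g (a :: s) = prod_roots ts.
Proof.
move=> b0 a0 zs0 sE; apply: gt0_roots_split; first by case: (lagp_monic g (a :: s)).
by move=> z /=; rewrite sE; exact: lag_step_root_gt0.
Qed.

(** Convexity of 1 / u: the graph lies above its tangent at u + d. *)
Lemma inv_shift_ge (u d : R) : 0 < u -> 0 < d ->
  d * (u + d) ^- 2 <= u^-1 - (u + d)^-1.
Proof.
move=> u0 d0; rewrite -subr_ge0.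
have -> : u^-1 - (u + d)^-1 - d * (u + d) ^- 2 = d ^+ 2 / (u * (u + d) ^+ 2).
  by field; rewrite !gt_eqF// addr_gt0.
by rewrite divr_ge0// ?sqr_ge0// mulr_ge0 ?sqr_ge0// ltW.
Qed.

Lemma sum_inv_shift_ge zs B (d : R) : all (< B) zs -> 0 < d ->
  d * sum_inv2 zs (B + d) <= sum_inv zs B - sum_inv zs (B + d).
Proof.
move=> zsB d0; rewrite /sum_inv /sum_inv2; elim: zs zsB => [|z zs IH] /=.
  by rewrite !big_nil mulr0 subrr.
case/andP=> zB /IH h; rewrite !big_cons mulrDr opprD addrACA lerD//.
have -> : B + d - z = B - z + d by ring.
by apply: inv_shift_ge => //; rewrite subr_gt0.
Qed.

Lemma sum_inv2_ge0 zs x : 0 <= sum_inv2 zs x.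
Proof. by apply: sumr_ge0 => z _; rewrite invr_ge0 sqr_ge0. Qed.

Lemma sum_inv_ge0 zs x : all (< x) zs -> 0 <= sum_inv zs x.
Proof.
move=> /allP h; rewrite /sum_inv big_seq; apply: sumr_ge0 => z /h zx.
by rewrite invr_ge0 subr_ge0 ltW.
Qed.

Lemma sum_inv_nincr zs B x : all (< B) zs -> B <= x ->
  sum_inv zs x <= sum_inv zs B.
Proof.
move=> /allP h Bx; rewrite /sum_inv big_seq [leRHS]big_seq; apply: ler_sum => z /h zB.
by move: zB => /= zB; rewrite lef_pV2 ?posrE; lra.
Qed.

(* The barrier argument of Marcus, Spielman and Srivastava: the logarithmic
   derivative at a point above the roots does not increase when that point is
   moved by [2 am] at each step. *)
Lemma lagp_barrier g am s : 0 < g -> 0 < am -> (size s)%:R - 1 < g ->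
  all (fun a => 0 < a <= am) s ->
  let B := 2 * am * (g + (size s)%:R) in
  exists zs, [/\ all (> 0) zs, all (< B) zs, lagp g s = prod_roots zs &
    (g - (size s)%:R) / B + sum_inv zs B <= (2 * am)^-1].
Proof.
move=> g0 am0; elim: s => [|a s IH] /=.
  move=> _ _; exists [::]; split => //; first by rewrite /prod_roots big_nil.
  (* Without steps B = 2 am g, and the potential g / B equals the allowed value. *)
  rewrite /sum_inv big_nil !addr0 subr0 le_eqVlt; apply/orP; left; apply/eqP.
  by field; rewrite !gt_eqF.
rewrite -natr1 addrK => sg /andP[/andP[a0 aam] sam].
have [|zs [zs0 zsB zsE zsP]] := IH _ sam; first by lra.
have b0 : 0 < g - (size s)%:R by rewrite subr_gt0.
have [ts ts0 tsE] := lagp_cons_roots b0 a0 zs0 zsE.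
set B := 2 * am * (g + (size s)%:R) in zsB zsP.
have -> : 2 * am * (g + ((size s)%:R + 1)) = B + 2 * am by rewrite /B; ring.
have B0 : 0 < B by rewrite /B mulr_gt0 ?mulr_gt0// ltr_wpDr.
have d0 : 0 < 2 * am by rewrite mulr_gt0.
have Phi x : B <= x -> (g - (size s)%:R) / x + sum_inv zs x <= (2 * am)^-1.
  move=> Bx; apply: le_trans zsP; rewrite lerD ?sum_inv_nincr//.
  by rewrite ler_pM2l// lef_pV2 ?posrE//; lra.
(* Hence the factor 1 - a Phi of [lag_step_horner] is at least 1/2 from B on, which excludes new
   roots there. *)
have aPhi x : B <= x -> a * ((g - (size s)%:R) / x + sum_inv zs x) <= 2^-1.
  move=> Bx; apply: (@le_trans _ _ (am * (2 * am)^-1)).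
    apply: ler_pM => //; [exact: ltW | apply: addr_ge0 | exact: Phi].
      by rewrite divr_ge0// ?ltW// (lt_le_trans B0).
    by apply: sum_inv_ge0; apply/allP => z /(allP zsB) zB; exact: lt_le_trans Bx.
  by rewrite le_eqVlt; apply/orP; left; apply/eqP; field; rewrite gt_eqF.
have zsN x : B <= x -> forall z, z \in zs -> x != z.
  by move=> Bx z /(allP zsB) zB; rewrite gt_eqF// (lt_le_trans zB).
have tsB : all (< B) ts.
  apply/allP => t tts /=; rewrite ltNge; apply/negP => Bt.
  have : (lagp g (a :: s)).[t] = 0.
    by rewrite tsE; apply/rootP; rewrite root_prod_XsubC.
  have t0 : 0 < t by exact: lt_le_trans Bt.
  rewrite /= zsE lag_step_horner ?gt_eqF//; last exact: zsN.
  move/eqP; rewrite !mulf_eq0 (negbTE (prod_roots_neq0 (zsN _ Bt))).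
  rewrite (gt_eqF t0) /= subr_eq0 => /eqP h.
  by have := aPhi _ Bt; rewrite -h; lra.
exists ts; split => //.
  by apply/allP => t /(allP tsB) /= h; rewrite (lt_trans h)// ltrDl.
have BB : B <= B + 2 * am by rewrite lerDl ltW.
have C0 : 0 < B + 2 * am by rewrite addr_gt0.
rewrite (@lag_step_log_deriv _ (g - (size s)%:R) a zs ts); last 4 first.
- by rewrite gt_eqF.
- exact: zsN.
- by move=> t /(allP tsB) h; rewrite gt_eqF// (lt_le_trans h).
- by rewrite -tsE -zsE.
set b := g - (size s)%:R in b0 zsP Phi aPhi *.
set C := B + 2 * am in BB C0 *.
set P := b / C + sum_inv zs C.
set Q := b / C ^+ 2 + sum_inv2 zs C.
(* The term C^-1 gained in the step is what the drop of b by 1 takes away, so at C the potential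
   grows by a Q / (1 - a P) only. *)
have -> : (g - ((size s)%:R + 1)) / C +
    (sum_inv zs C + C^-1 + a * Q / (1 - a * P)) = P + a * Q / (1 - a * P).
  by move: (a * Q / _) => E; rewrite /P /b; field; rewrite gt_eqF.
apply: le_trans zsP.
have Q0 : 0 <= Q by rewrite addr_ge0 ?sum_inv2_ge0// divr_ge0 ?sqr_ge0// ltW.
have aP := aPhi _ BB; rewrite -/P in aP.
(* As 1 - a P is at least 1/2, the growth is at most 2 am Q. By convexity, moving from B to B + 2 am
   lowers the potential by at least this amount, which explains the size of the shift. *)
have h1 : a * Q / (1 - a * P) <= 2 * am * Q.
  rewrite ler_pdivrMr; last by lra.
  rewrite mulrAC ler_wpM2r//; nra.
have h2 : 2 * am * Q <= b / B + sum_inv zs B - P.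
  rewrite /Q /P mulrDr opprD addrACA lerD ?sum_inv_shift_ge//.
  have := inv_shift_ge B0 d0; rewrite -/C -mulrBr => h.
  by rewrite mulrCA ler_pM2l.
lra.
Qed.

End RootLocation.

(** * Multiple orthogonality *)

Section GammaIntegral.
Variable R : realType.
Implicit Types p q c x : R.
Notation mu := (@lebesgue_measure R).

Definition gamma_fun p c x := x `^ p * expR (- c * x).

Lemma gamma_fun_ge0 p c x : 0 <= gamma_fun p c x.
Proof. by rewrite mulr_ge0 ?powR_ge0 ?expR_ge0. Qed.

Lemma measurable_gamma_fun p c : measurable_fun setT (gamma_fun p c).
Proof.
apply: measurable_funM; first exact: measurable_powR.
by apply: measurableT_comp => //; exact: measurable_funM.
Qed.

Lemma is_derive_gamma_fun p c x : 0 < x ->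
  is_derive x 1 (gamma_fun p c)
    (p * gamma_fun (p - 1) c x - c * gamma_fun p c x).
Proof.
move=> x0; have h1 := is_derive1_powR p x0.
have h2 : is_derive x 1 (fun x => expR (- c * x)) (- c * expR (- c * x)).
  have h3 : is_derive x 1 (fun x : R => - c * x) (- c).
    by apply: is_derive_eq; rewrite /GRing.scale /= mulr1.
  by apply: is_derive_eq; rewrite /GRing.scale /=; ring.
apply: is_derive_eq; rewrite /gamma_fun /GRing.scale /=; ring.
Qed.

Lemma continuous_gamma_fun p c x : 0 < x -> {for x, continuous (gamma_fun p c)}.
Proof.
move=> x0; apply/differentiable_continuous/derivable1_diffP.
by have [] := is_derive_gamma_fun p c x0.
Qed.

Lemma powR_le_expR q c : 0 <= q -> 0 < c ->
  exists K, forall x, 0 < x -> x `^ q <= K * expR (c * x).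
Proof.
move=> q0 c0; pose n := Num.truncn q.
exists (1 + (n.+1)`!%:R * c^-1 ^+ n.+1) => x x0.
have e1 : 1 <= expR (c * x) by rewrite -expR0 ler_expR mulr_ge0// ltW.
have e2 : x ^+ n.+1 <= (n.+1)`!%:R * c^-1 ^+ n.+1 * expR (c * x).
  have := @expR_ge1Dxn R (c * x) n (mulr_ge0 (ltW c0) (ltW x0)) => h.
  have : (c * x) ^+ n.+1 / (n.+1)`!%:R <= expR (c * x) by lra.
  rewrite ler_pdivrMr ?ltr0n ?fact_gt0// exprMn -ler_pdivlMl ?exprn_gt0// => h'.
  by apply: le_trans h' _; rewrite exprVn; lra.
have e3 : x `^ q <= 1 + x ^+ n.+1.
  have [x1|x1] := leP x 1.
    apply: (@le_trans _ _ 1); last by rewrite lerDl exprn_ge0// ltW.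
    have := @ge0_ler_powR R q q0 x 1 _ _ x1.
    by rewrite powR1 !nnegrE; apply => //; exact: ltW.
  apply: (@le_trans _ _ (x ^+ n.+1)); last by rewrite lerDr.
  rewrite -powR_mulrn ?(ltW x0)// ler_powR ?(ltW x1)//.
  by rewrite ltW// truncnS_gt.
rewrite mulrDl mul1r; apply: (le_trans e3); apply: lerD => //.
Qed.

(** Half of the exponential absorbs x^q; the other half is a multiple of an exponential density of
    rate c / 2. *)
Lemma integrable_gamma_fun_ge0 q c : 0 <= q -> 0 < c ->
  mu.-integrable `]0, +oo[ (EFin \o gamma_fun q c).
Proof.
move=> q0 c0; have c20 : 0 < c / 2 by rewrite divr_gt0.
have [K KP] := powR_le_expR q0 c20.
apply: (@le_integrable _ _ R mu _ _ _
    (EFin \o (fun x : R => (K * (c / 2)^-1) * exponential_pdf (c / 2) x))) => //.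
- by apply/measurable_EFinP/measurable_funTS; exact: measurable_gamma_fun.
- move=> x /=; rewrite in_itv/= andbT => x0.
  rewrite lee_fin ger0_norm ?gamma_fun_ge0//.
  rewrite exponential_pdfE ?(ltW x0)// /gamma_fun.
  apply: (@le_trans _ _ (K * expR (c / 2 * x) * expR (- c * x))).
    by rewrite ler_wpM2r ?expR_ge0// KP.
  apply: le_trans (ler_norm _); rewrite le_eqVlt; apply/orP; left; apply/eqP.
  rewrite -mulrA -expRD.
  rewrite -[RHS]mulrA; congr (K * _); rewrite mulKf ?lt0r_neq0//.
  by congr expR; field.
- have := integrable_exponential_pdf c20 => h.
  have h' : mu.-integrable `]0%R, +oo[ (EFin \o exponential_pdf (c / 2)).
    exact: (integrableS _ _ _ h).
  exact: (integrableZl _ _ h').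
Qed.

Lemma gamma_fun_cvgy q c : 0 <= q -> 0 < c ->
  gamma_fun q c n.+2%:R @[n --> \oo] --> 0.
Proof.
move=> q0 c0; have c20 : 0 < c / 2 by rewrite divr_gt0.
have [K KP] := powR_le_expR q0 c20.
apply: (@squeeze_cvgr _ _ _ _ (cst 0) (fun n : nat => K * expR (- (c / 2 * n.+2%:R)))).
- near=> n; rewrite gamma_fun_ge0 /=.
  have n0 : (0 : R) < n.+2%:R by [].
  apply: (@le_trans _ _ (K * expR (c / 2 * n.+2%:R) * expR (- c * n.+2%:R))).
    by rewrite ler_wpM2r ?expR_ge0// KP.
  by rewrite -mulrA -expRD le_eqVlt; apply/orP; left; apply/eqP; congr (_ * expR _); field.
- exact: cvg_cst.
- rewrite -[X in _ --> X](mulr0 K); apply: cvgMr.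
  apply: (@cvg_comp _ _ _ (fun n : nat => c / 2 * n.+2%:R) (fun x => expR (- x)) _ +oo _ _ (@cvgr_expR R)).
  apply/cvgryPge => B; near=> n; rewrite mulrC -ler_pdivrMr//.
  apply: (@le_trans _ _ n%:R); last by rewrite ler_nat ltnW.
  by near: n; exact: nbhs_infty_ger.
Unshelve. all: by end_near. Qed.

Lemma gamma_fun_cvg0 q c : 0 < q -> gamma_fun q c n.+1%:R^-1 @[n --> \oo] --> 0.
Proof.
move=> q0.
have h := @cvg_harmonic R.
have h1 : n.+1%:R^-1 `^ q @[n --> \oo] --> (0 : R).
  exact: ((cvg_at_rightP _ _ _).1 (powR_cvg0 q0)).
have h2 : expR (- c * n.+1%:R^-1) @[n --> \oo] --> (1 : R).
  rewrite -[X in _ --> X](@expR0 R) -[X in _ --> expR X](mulr0 (- c)).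
  by apply: continuous_cvg; [exact: continuous_expR | exact: cvgMr].
by rewrite -[X in _ --> X](mul0r (1 : R)); apply: cvgM.
Qed.

(** Integration by parts on growing segments, then monotone convergence. Being an identity of
    extended reals, it holds before integrability is known for -1 < p < 0, and
    [integrable_gamma_fun] deduces that integrability from the exponent p + 1 > 0. *)
Lemma integral_gamma_fun_rec p c : -1 < p -> 0 < c ->
  ((p + 1)%:E * \int[mu]_(x in `]0%R, +oo[) (gamma_fun p c x)%:E =
   c%:E * \int[mu]_(x in `]0%R, +oo[) (gamma_fun (p + 1) c x)%:E)%E.
Proof.
move=> p1 c0; pose q := p + 1; have q0 : 0 < q by rewrite /q; lra.
(* The segments avoid 0, where x^p may be unbounded; the upper end n + 2 makes the segment
   nondegenerate already for n = 0. *)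
pose A (n : nat) : set R := [set` `[n.+1%:R^-1, n.+2%:R]].
have A0 n x : A n x -> 0 < x.
  by rewrite /A /= in_itv/= => /andP[h _]; exact: lt_le_trans h.
have AU : `]0, +oo[%classic = \bigcup_n A n.
  apply/seteqP; split => [x|x [n _]]; rewrite /A /= !in_itv/= ?andbT.
    move=> x0; pose n := maxn (Num.truncn x) (Num.truncn x^-1); exists n => //=.
    rewrite in_itv/=; apply/andP; split.
      rewrite invf_ple ?posrE//; apply: ltW.
      by apply: (lt_le_trans (truncnS_gt _)); rewrite ler_nat ltnS leq_maxr.
    by apply: ltW; apply: (lt_le_trans (truncnS_gt _)); rewrite ler_nat ltnS leqW// leq_maxl.
  by move=> /andP[h _]; exact: lt_le_trans h.
have Aih : {homo A : n m / (n <= m)%N >-> (n <= m)%O}.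
  move=> n m nm; apply/subsetPset => x; rewrite /A /= !in_itv/= => /andP[h1 h2].
  apply/andP; split; first by rewrite (le_trans _ h1)// lef_pV2 ?posrE// ler_nat ltnS.
  by rewrite (le_trans h2)// ler_nat !ltnS.
have lim p' : (\int[mu]_(x in A n) (gamma_fun p' c x)%:E)%E @[n --> \oo] -->
    (\int[mu]_(x in `]0%R, +oo[) (gamma_fun p' c x)%:E)%E.
  rewrite AU; apply: ge0_nondecreasing_set_cvg_integral => //.
  - by move=> n; exact: measurable_itv.
  - by move=> n; apply/measurable_EFinP/measurable_funTS; exact: measurable_gamma_fun.
  - by move=> n x _; rewrite lee_fin gamma_fun_ge0.
have cA p' n : {within A n, continuous (gamma_fun p' c)}.
  apply: continuous_in_subspaceT => x /[!inE] /A0; exact: continuous_gamma_fun.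
have iA p' n : mu.-integrable (A n) (EFin \o gamma_fun p' c).
  apply: continuous_compact_integrable => //; exact: segment_compact.
have eqA n : (q%:E * \int[mu]_(x in A n) (gamma_fun p c x)%:E =
   c%:E * \int[mu]_(x in A n) (gamma_fun q c x)%:E +
   (gamma_fun q c n.+2%:R - gamma_fun q c n.+1%:R^-1)%:E)%E.
  have ab : n.+1%:R^-1 < n.+2%:R :> R.
    by rewrite (@le_lt_trans _ _ 1) ?ltr1n// invf_le1// ler1n.
  have F' x : 0 < x -> is_derive x 1 (gamma_fun q c)
      (q * gamma_fun p c x - c * gamma_fun q c x).
    by move=> x0; have := is_derive_gamma_fun q c x0; rewrite /q addrK.
  have := @continuous_FTC2 R (fun x => q * gamma_fun p c x - c * gamma_fun q c x)
    (gamma_fun q c) _ _ ab.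
  rewrite -/(A n) => /(_ _ _ _)/wrap[].
  - move=> x; apply: cvgB; apply: cvgM; do ? exact: cvg_cst; exact: cA.
  - split.
    + by move=> x; rewrite in_itv/= => /andP[h _]; have [] := F' x (lt_trans _ h).
    + by apply/cvg_at_right_filter/continuous_gamma_fun.
    + by apply/cvg_at_left_filter/continuous_gamma_fun.
  - move=> x; rewrite in_itv/= => /andP[h _]; rewrite derive1E.
    have x0 : 0 < x by rewrite (lt_trans _ h).
    by have := F' x x0 => ?; rewrite derive_val.
  under eq_integral do rewrite EFinB (EFinM q) (EFinM c).
  have iZ k p' : mu.-integrable (A n) (fun x => k%:E * (gamma_fun p' c x)%:E)%E.
    by apply: (integrableZl _ k (iA p' n)); exact: measurable_itv.
  rewrite (integralB _ (iZ _ _) (iZ _ _)); last exact: measurable_itv.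
  rewrite (integralZl _ (iA p n)); last exact: measurable_itv.
  rewrite (integralZl _ (iA q n)); last exact: measurable_itv.
  rewrite -EFinB => <-.
  rewrite addeCA subee ?adde0//.
  by rewrite fin_numM//; apply: integrable_fin_num (iA q n); exact: measurable_itv.
have limL : (q%:E * \int[mu]_(x in A n) (gamma_fun p c x)%:E)%E @[n --> \oo] -->
    (q%:E * \int[mu]_(x in `]0%R, +oo[) (gamma_fun p c x)%:E)%E.
  exact: cvgeZl.
have limR : (q%:E * \int[mu]_(x in A n) (gamma_fun p c x)%:E)%E @[n --> \oo] -->
    (c%:E * \int[mu]_(x in `]0%R, +oo[) (gamma_fun q c x)%:E)%E.
  rewrite (funext eqA) -[X in _ --> X]adde0; apply: cvgeD.
  - by rewrite fin_num_adde_defl.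
  - exact: cvgeZl.
  - apply: cvg_EFin; first exact: nearW.
    rewrite -(subrr (0 : R)); apply: cvgB; first exact: gamma_fun_cvgy (ltW q0) c0.
    exact: gamma_fun_cvg0.
exact: (cvg_unique _ limL limR).
Qed.

Lemma integrable_gamma_fun p c : -1 < p -> 0 < c ->
  mu.-integrable `]0, +oo[ (EFin \o gamma_fun p c).
Proof.
move=> p1 c0; have q0 : 0 < p + 1 by lra.
apply/integrableP; split.
  by apply/measurable_EFinP/measurable_funTS; exact: measurable_gamma_fun.
under eq_integral do rewrite /= ger0_norm ?gamma_fun_ge0//.
have := integral_gamma_fun_rec p1 c0; rewrite -/mu.
have := integrable_fin_num _ (integrable_gamma_fun_ge0 (ltW q0) c0).
move=> /(_ (measurable_itv _))/fineK <-; rewrite -EFinM.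
case: (integral _ _ _) => [r||] //; first by rewrite ltry.
by rewrite gt0_muley ?lte_fin.
Qed.

Lemma integral_gamma_fun_gt0 p c : -1 < p -> 0 < c ->
  (0 < \int[mu]_(x in `]0%R, +oo[) (gamma_fun p c x)%:E)%E.
Proof.
move=> p1 c0; have [k k0 kP] : exists2 k : R, 0 < k &
    forall x, 1 <= x <= 2 -> k <= gamma_fun p c x.
  exists (Num.min 1 (2 `^ p) * expR (- c * 2)).
    by rewrite mulr_gt0 ?expR_gt0// lt_min ltr01 powR_gt0.
  move=> x /andP[x1 x2]; have x0 : 0 < x by lra.
  apply: ler_pM; rewrite ?expR_ge0 ?le_min ?ler01 ?powR_ge0//; last first.
    by rewrite ler_expR !mulNr lerN2 ler_pM2l.
  rewrite ge_min; have [p0|p0] := leP 0 p; apply/orP; [left|right].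
    by rewrite -[leLHS](powRr0 x) ler_powR.
  rewrite -(opprK p) powRN [leRHS]powRN lef_pV2 ?posrE ?powR_gt0//.
  have := @ge0_ler_powR R (- p) _ x 2 _ _ x2.
  by rewrite !nnegrE; apply => //; lra.
apply: (@lt_le_trans _ _ (\int[mu]_(x in `[1%R, 2%R]) k%:E)%E).
  rewrite integral_cst//= lebesgue_measure_itv/= lte_fin ltr1n -EFinB -EFinM lte_fin.
  by rewrite mulr_gt0//; lra.
apply: (@le_trans _ _ (\int[mu]_(x in `[1%R, 2%R]) (gamma_fun p c x)%:E)%E).
  apply: ge0_le_integral => //.
  - by move=> x _; rewrite lee_fin ltW.
  - by apply/measurable_EFinP/measurable_funTS; exact: measurable_gamma_fun.
apply: ge0_subset_integral => //.
- by apply/measurable_EFinP/measurable_funTS; exact: measurable_gamma_fun.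
- by move=> x _; rewrite lee_fin gamma_fun_ge0.
- by move=> x; rewrite /= !in_itv/= andbT => /andP[x1 _]; lra.
Qed.

End GammaIntegral.

(** * From the orthogonality relations to the product of steps *)

Section MultipleOrthogonality.
Variable R : realType.
Implicit Types (a b c p alpha : R) (P H : {poly R}).
Notation mu := (@lebesgue_measure R).

Definition rising b n : R := \prod_(l < n) (b + l%:R).

Lemma risingS b n : rising b n.+1 = rising b n * (b + n%:R).
Proof. by rewrite /rising big_ord_recr. Qed.

Lemma risingSl b n : rising b n.+1 = b * rising (b + 1) n.
Proof.
rewrite /rising big_ord_recl addr0; congr (_ * _); apply: eq_bigr => i _.
by rewrite /= /bump /= natrD addrA.
Qed.

Lemma rising_gt0 b n : 0 < b -> 0 < rising b n.
Proof. by move=> b0; apply: prodr_gt0 => l _; rewrite ltr_pwDl. Qed.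

Lemma fallingSl (g : R) n : falling g n.+1 = g * falling (g - 1) n.
Proof.
rewrite /falling big_ord_recl subr0; congr (_ * _); apply: eq_bigr => i _.
by rewrite /= /bump /= natrD opprD addrA.
Qed.

(** For b = alpha + 1 and i + k = |n| the falling factorial starts at |n| + alpha = g: this is how
    the factor of [coef_lagp] arises from the quotient of two rising factorials. *)
Lemma rising_falling b i k :
  rising b (i + k) = rising b i * falling (b + (i + k)%:R - 1) k.
Proof.
elim: k => [|k IH]; first by rewrite addn0 /falling big_ord0 mulr1.
rewrite addnS risingS IH fallingSl -addnS.
have -> : b + (i + k.+1)%:R - 1 = b + (i + k)%:R by rewrite addnS -natr1; ring.
ring.
Qed.

Lemma rising_add b i k : rising b (i + k) = rising b i * rising (b + i%:R) k.
Proof.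
elim: k => [|k IH]; first by rewrite addn0 /rising big_ord0 mulr1.
by rewrite addnS !risingS IH natrD; ring.
Qed.

(** For p > -1 and c > 0 this is Gamma(p + 1) / c^(p + 1); only its recursion in p and its
    positivity are used. *)
Definition gamma_int p c : R := (\int[mu]_(x in `]0%R, +oo[) gamma_fun p c x)%R.

Lemma EFin_gamma_int p c : -1 < p -> 0 < c ->
  (\int[mu]_(x in `]0%R, +oo[) (gamma_fun p c x)%:E)%E = (gamma_int p c)%:E.
Proof.
move=> p1 c0; rewrite /gamma_int /Rintegral fineK//.
by apply: (integrable_fin_num _ (integrable_gamma_fun p1 c0)); exact: measurable_itv.
Qed.

Lemma gamma_intS p c : -1 < p -> 0 < c ->
  gamma_int (p + 1) c = (p + 1) / c * gamma_int p c.
Proof.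
move=> p1 c0; have := integral_gamma_fun_rec p1 c0.
rewrite !EFin_gamma_int//; last by lra.
rewrite -!EFinM => -[] h.
by rewrite mulrAC h mulrAC divff ?mul1r// gt_eqF.
Qed.

Lemma gamma_int_gt0 p c : -1 < p -> 0 < c -> 0 < gamma_int p c.
Proof.
move=> p1 c0; have := integral_gamma_fun_gt0 p1 c0.
by rewrite EFin_gamma_int// lte_fin.
Qed.

Lemma gamma_int_addn p c n : -1 < p -> 0 < c ->
  gamma_int (n%:R + p) c = rising (p + 1) n / c ^+ n * gamma_int p c.
Proof.
move=> p1 c0; elim: n => [|n IH].
  by rewrite add0r /rising big_ord0 expr0 divr1 mul1r.
have -> : n.+1%:R + p = (n%:R + p) + 1 by rewrite -natr1; ring.
rewrite (gamma_intS _ c0); last by rewrite -(add0r (-1)) ler_ltD.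
by rewrite IH risingS exprS; field; rewrite expf_neq0 gt_eqF.
Qed.

Lemma integral_poly_gamma P alpha c k : -1 < alpha -> 0 < c ->
  (\int[mu]_(x in `]0%R, +oo[)
     (P.[x] * x `^ (k%:R + alpha) * expR (- c * x))%:E =
   ((\sum_(i < size P) P`_i * rising (alpha + 1) (i + k) / c ^+ (i + k)) *
      gamma_int alpha c)%:E)%E.
Proof.
move=> a1 c0.
have ak n : -1 < n%:R + alpha by rewrite -(add0r (-1)) ler_ltD.
transitivity (\int[mu]_(x in `]0%R, +oo[)
    (\sum_(i < size P) (P`_i)%:E * (gamma_fun ((i + k)%:R + alpha) c x)%:E))%E.
  apply: eq_integral => x /[!inE] /=; rewrite in_itv/= andbT => x0.
  rewrite (eq_bigr (fun i : 'I__ => (P`_i * gamma_fun ((i + k)%:R + alpha) c x)%:E)) //.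
  rewrite sumEFin; congr EFin; rewrite horner_coef !mulr_suml.
  apply: eq_bigr => i _; rewrite /gamma_fun natrD -addrA (@powRD _ x i%:R).
    by rewrite powR_mulrn ?(ltW x0)// !mulrA.
  by rewrite (gt_eqF x0) implybT.
have iP i : mu.-integrable `]0%R, +oo[
    (fun x => (P`_i)%:E * (gamma_fun ((i + k)%:R + alpha) c x)%:E)%E.
  apply: (integrableZl _ _ (integrable_gamma_fun (ak _) c0)); exact: measurable_itv.
rewrite integral_sum//=.
rewrite mulr_suml -sumEFin; apply: eq_bigr => i _.
rewrite (integralZl _ (integrable_gamma_fun (ak _) c0)); last exact: measurable_itv.
by rewrite (EFin_gamma_int (ak _) c0) -EFinM (gamma_int_addn _ a1 c0) !mulrA.
Qed.

(** The factor (alpha + 1)_(i + k) of the moment splits as (alpha + 1)_i (alpha + 1 + i)_k. The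
    first factor defines the transform of P; the second is the form in which [euler_dvdp] expects
    its conditions. *)
Lemma orthogonality_coef P alpha c k : -1 < alpha -> 0 < c ->
  (\int[mu]_(x in `]0%R, +oo[)
     (P.[x] * x `^ (k%:R + alpha) * expR (- c * x))%:E = 0)%E ->
  \sum_(i < size P) P`_i * rising (alpha + 1) i *
     rising (alpha + 1 + i%:R) k * c^-1 ^+ i = 0.
Proof.
move=> a1 c0; rewrite integral_poly_gamma// => -[] /eqP.
rewrite mulf_eq0 (gt_eqF (gamma_int_gt0 a1 c0)) orbF => /eqP h.
apply: (mulIf (expf_neq0 k (invr_neq0 (lt0r_neq0 c0)))).
rewrite mul0r -[RHS]h mulr_suml; apply: eq_bigr => i _.
by rewrite rising_add !exprVn exprD; field; rewrite !expf_neq0// gt_eqF.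
Qed.

Lemma dvdp_exp_XsubC_root (a : R) n m (G : {poly R}) :
  ('X - a%:P) ^+ n %| ('X - a%:P) ^+ m * G -> ~~ root G a -> (n <= m)%N.
Proof.
move=> h G0; rewrite leqNgt; apply: contra G0 => mn.
have X0 : ('X - a%:P) ^+ m != 0 by rewrite expf_neq0// polyXsubC_eq0.
move: h; rewrite -(subnKC mn) addSnnS exprD dvdp_mul2l// exprS => h.
by rewrite root_factor_theorem (dvdp_trans _ h)// dvdp_mulr.
Qed.

(* The operator [H |-> X H' + b H] lowers the order of vanishing at [a != 0] by
   exactly one. *)
Lemma euler_dvdp n H a b N : a != 0 -> (size H <= N)%N ->
  (forall k, (k < n)%N -> \sum_(i < N) H`_i * rising (b + i%:R) k * a ^+ i = 0) ->
  ('X - a%:P) ^+ n %| H.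
Proof.
elim: n H b => [|n IH] H b a0 HN hk; first by rewrite expr0 dvd1p.
pose H1 := 'X * H^`() + b *: H.
have H1E i : H1`_i = (b + i%:R) * H`_i.
  rewrite coefD coefZ coefXM coef_deriv; case: i => [|i] /=.
    by rewrite add0r addr0.
  by rewrite -mulr_natr; ring.
have H1N : (size H1 <= N)%N.
  by apply/leq_sizeP => i Ni; rewrite H1E nth_default ?mulr0// (leq_trans HN).
(* Since (b + i)_(k + 1) = (b + i) (b + i + 1)_k, condition k + 1 for H and b is condition k for H1
   and b + 1; condition 0 says that a is a root of H. *)
have d1 : ('X - a%:P) ^+ n %| H1.
  apply: (IH _ (b + 1)) => // k kn; rewrite -[RHS](hk k.+1)//.
  by apply: eq_bigr => i _; rewrite H1E risingSl addrAC; ring.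
have Ha : root H a.
  apply/rootP; rewrite (horner_coef_wide _ HN) -[RHS](hk 0%N)//.
  by apply: eq_bigr => i _; rewrite /rising big_ord0 mulr1.
have [->|H0] := eqVneq H 0; first exact: dvdp0.
have [m [G G0 HG]] := multiplicity_XsubC H a; rewrite H0 /= in G0.
case: m HG => [|m] HG.
  by move: Ha G0; rewrite HG expr0 mulr1 => ->.
(* If H vanishes to order exactly m + 1, the cofactor of H1 takes at a the value (m + 1) a G(a),
   which is nonzero. *)
have d2 : H1 = ('X - a%:P) ^+ m *
    (m.+1%:R *: ('X * G) + ('X - a%:P) * ('X * G^`() + b *: G)).
  rewrite /H1 HG derivM deriv_exp derivXsubC mul1r /= exprS.
  rewrite -!mul_polyC -mulr_natl polyC_natr; ring.
rewrite d2 in d1; have := dvdp_exp_XsubC_root d1.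
rewrite /root !hornerE subrr mul0r addr0 !mulf_eq0 pnatr_eq0 /= (negbTE a0) => /(_ G0) nm.
by rewrite HG dvdp_mull// dvdp_exp2l.
Qed.

Lemma prod_coprime_dvdp (I : eqType) (js : seq I) (f : I -> {poly R}) H :
  uniq js -> {in js &, forall i j, i != j -> coprimep (f i) (f j)} ->
  {in js, forall j, f j %| H} -> \prod_(j <- js) f j %| H.
Proof.
elim: js => [|j js IH] /=; first by rewrite big_nil dvd1p.
case/andP=> jN ujs cop dv; rewrite big_cons Gauss_dvdp; last first.
  rewrite big_seq; elim/big_rec: _ => [|i q ijs h]; first exact: coprimep1.
  rewrite coprimepMr h andbT cop ?mem_head ?inE ?ijs ?orbT//.
  by apply: contraNneq jN => ->.
rewrite dv ?mem_head//=; apply: IH => //.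
  by move=> i k ijs kjs; apply: cop; rewrite inE ?ijs ?kjs orbT.
by move=> i ijs; apply: dv; rewrite inE ijs orbT.
Qed.

Definition rate_seq (r : nat) (c : 'I_r -> R) (n : 'I_r -> nat) : seq R :=
  flatten [seq nseq (n j) (c j)^-1 | j <- enum 'I_r].

Lemma big_rate_seq (V : zmodType) (r : nat) (c : 'I_r -> R) (n : 'I_r -> nat)
    (F : R -> V) :
  \sum_(a <- rate_seq c n) F a = \sum_(j < r) F (c j)^-1 *+ n j.
Proof.
rewrite /rate_seq big_flatten big_map big_enum; apply: eq_bigr => j _ /=.
by elim: (n j) => [|k IH]; rewrite ?big_nil//= big_cons IH mulrS.
Qed.

Lemma size_rate_seq r (c : 'I_r -> R) n : size (rate_seq c n) = msize n.
Proof.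
rewrite /rate_seq size_flatten /shape -map_comp sumnE big_map big_enum.
by apply: eq_bigr => j _ /=; rewrite size_nseq.
Qed.

Lemma prod_roots_rate_seq r (c : 'I_r -> R) n :
  prod_roots (rate_seq c n) = \prod_(j <- enum 'I_r) ('X - (c j)^-1%:P) ^+ n j.
Proof.
rewrite /prod_roots /rate_seq big_flatten big_map; apply: eq_bigr => j _ /=.
by elim: (n j) => [|k IH]; rewrite ?big_nil//= big_cons IH exprS.
Qed.

(* In the variable [1 / c] the orthogonality relations say that the transform
   [sum_i P_i (alpha + 1)_i X^i] vanishes to order [n j] at [1 / c j]. *)
Lemma multiple_laguerre2E r alpha (c : 'I_r -> R) (n : 'I_r -> nat) P :
  -1 < alpha -> (forall j, 0 < c j) -> (forall i j, i != j -> c i != c j) ->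
  is_multiple_laguerre2 alpha c n P ->
  P = lagp ((msize n)%:R + alpha) (rate_seq c n).
Proof.
move=> a1 c0 cN [Pm Ps orth]; have b0 : 0 < alpha + 1 by lra.
pose H := \poly_(i < size P) (P`_i * rising (alpha + 1) i).
have HE i : H`_i = P`_i * rising (alpha + 1) i.
  rewrite coef_poly; case: ltnP => // iP; by rewrite nth_default ?mul0r.
have PN : P`_(msize n) = 1 by move/monicP: Pm; rewrite lead_coefE Ps.
have Hs : size H = (msize n).+1.
  rewrite -Ps size_poly_eq// Ps /= PN mul1r gt_eqF// rising_gt0//.
have hdvd : prod_roots (rate_seq c n) %| H.
  rewrite prod_roots_rate_seq; apply: prod_coprime_dvdp.
  - exact: enum_uniq.
  - move=> i j _ _ ij; apply: coprimep_expl; apply: coprimep_expr.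
    by rewrite coprimep_XsubC root_XsubC (inj_eq invr_inj) eq_sym cN// eq_sym.
  move=> j _; apply: (@euler_dvdp _ _ _ (alpha + 1) (size P)).
  - by rewrite invr_neq0// gt_eqF.
  - exact: size_poly.
  move=> k kn; have := orthogonality_coef a1 (c0 j) (orth j k kn) => h.
  by rewrite -[RHS]h; apply: eq_bigr => i _; rewrite HE.
(* Both sides have degree |n|, so divisibility already gives proportionality. *)
have heq : prod_roots (rate_seq c n) %= H.
  by rewrite -dvdp_size_eqp// size_prod_roots size_rate_seq Hs.
have hm : prod_roots (rate_seq c n) \is monic by exact: monic_prod_XsubC.
have HP : H = rising (alpha + 1) (msize n) *: prod_roots (rate_seq c n).
  move/eqpP: heq => [[u v] /= /andP[u0 v0] uv].
  have HuV : H = (u / v) *: prod_roots (rate_seq c n).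
    by rewrite mulrC -scalerA uv scalerA mulVf// scale1r.
  rewrite HuV; congr (_ *: _).
  have := congr1 lead_coef HuV; rewrite lead_coefZ (monicP hm) mulr1 => <-.
  by rewrite lead_coefE Hs HE PN mul1r.
apply/polyP => i; rewrite coef_lagp size_rate_seq.
have [iN|iN] := ltnP (msize n) i.
  rewrite nth_default ?Ps// [(prod_roots _)`_i]nth_default ?mulr0//.
  by rewrite size_prod_roots size_rate_seq.
apply: (mulIf (lt0r_neq0 (rising_gt0 i b0))).
rewrite -HE HP coefZ -{1}(subnKC iN) rising_falling subnKC//.
have -> : alpha + 1 + (msize n)%:R - 1 = (msize n)%:R + alpha by ring.
ring.
Qed.

End MultipleOrthogonality.

(** * Polynomial approximation *)

Section Weierstrass.
Variable R : realType.
Implicit Types (x : R) (f g : nat -> R) (h : R -> R).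

(** The Bernstein operator in recursive form: the value at x is the expectation of f(S), where S
    counts the successes in n independent trials of probability x, and the recursion conditions on
    one trial. The argument of f is the count itself, not the count divided by n. *)
Fixpoint bernstein n f : {poly R} :=
  if n is k.+1 then (1 - 'X) * bernstein k f + 'X * bernstein k (f \o S)
  else (f 0%N)%:P.

Lemma bernsteinS n f x : (bernstein n.+1 f).[x] =
  (1 - x) * (bernstein n f).[x] + x * (bernstein n (f \o S)).[x].
Proof. by rewrite /= !hornerE. Qed.

Lemma bernstein_le n f g x : 0 <= x <= 1 ->
  (forall k, (k <= n)%N -> f k <= g k) ->
  (bernstein n f).[x] <= (bernstein n g).[x].
Proof.
move=> /andP[x0 x1]; elim: n f g => [|n IH] f g fg.
  by rewrite /= !hornerC fg.
rewrite !bernsteinS lerD// ler_wpM2l ?subr_ge0//; apply: IH => k kn.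
  by apply: fg; rewrite (leq_trans kn).
exact: fg.
Qed.

(** The binomial law has mean n x and variance n x (1 - x). *)
Lemma bernstein_quadratic n x a b d :
  (bernstein n (fun k => a + b * k%:R + d * k%:R ^+ 2)).[x] =
  a + b * (n%:R * x) + d * (n%:R * x * (1 - x) + (n%:R * x) ^+ 2).
Proof.
elim: n a b d => [|n IH] a b d; first by rewrite /= hornerC; ring.
have e : (fun k => a + b * k%:R + d * k%:R ^+ 2) \o S =
    (fun k => (a + b + d) + (b + 2 * d) * k%:R + d * k%:R ^+ 2) :> (nat -> R).
  by apply/funext => k /=; rewrite -natr1; ring.
by rewrite bernsteinS e !IH -natr1; ring.
Qed.

(* A modulus of continuity with a quadratic error term, which Bernstein
   operators evaluate exactly. *)
Lemma quadratic_modulus h (e : R) : continuous h -> 0 < e ->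
  exists2 K, 0 <= K & forall s t, 0 <= s <= 1 -> 0 <= t <= 1 ->
    `|h s - h t| <= e + K * (s - t) ^+ 2.
Proof.
move=> ch e0.
have [B hB] : exists B, forall t, 0 <= t <= 1 -> `|h t| <= B.
  have ch' : {within `[0, 1], continuous (fun t => `|h t|)}.
    apply: continuous_subspaceT => t; apply: cvg_norm; exact: ch.
  have [d _ hd] := EVT_max ler01 ch'; exists `|h d| => t t01.
  by apply: hd; rewrite in_itv.
have /compact_near_coveringP cK := @segment_compact R 0 1.
have := cK nat \oo (fun n s => 0 <= s <= 1 -> forall t, 0 <= t <= 1 ->
  `|h s - h t| <= e + n%:R * (s - t) ^+ 2) _.
move=> /(_ _) [].
  move=> s0; rewrite /= in_itv /= => s001.
  have /cvgrPdist_lt/(_ _ (divr_gt0 e0 (ltr0n R 2)))/nbhs_ballP[d /= d0 hd] := ch s0.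
  have hd' t : `|s0 - t| < d -> `|h s0 - h t| < e / 2 by move=> ?; apply: hd.
  exists (ball s0 (d / 2), [set n : nat | 2 * B <= n%:R * (d / 2) ^+ 2]).
    split => /=; first by apply: nbhsx_ballx; rewrite divr_gt0.
    near=> n; rewrite /= -ler_pdivrMr ?exprn_gt0 ?divr_gt0//.
    by near: n; exact: nbhs_infty_ger.
  move=> [s n] /= [sd nB] s01 t t01.
  have sd' : `|s0 - s| < d / 2 by [].
  (* If t is close to s0, continuity at s0 gives e; otherwise |s - t| is at least d / 2 and the
     quadratic term exceeds the crude bound 2 B. *)
  have [td|td] := ltP `|s0 - t| d.
    have h1 := hd' _ td; have h2 : `|h s0 - h s| < e / 2 by apply: hd'; lra.
    have -> : h s - h t = (h s0 - h t) - (h s0 - h s) by ring.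
    apply: (@le_trans _ _ e); last by rewrite lerDl mulr_ge0 ?sqr_ge0.
    by apply: (le_trans (ler_normB _ _)); lra.
  have h1 : d / 2 <= `|s - t|.
    have := ler_distD s s0 t => h3; lra.
  apply: (@le_trans _ _ (2 * B)).
    apply: (le_trans (ler_normB _ _)); have := hB _ t01; have := hB _ s01; lra.
  apply: (le_trans nB); apply: (@le_trans _ _ (n%:R * (s - t) ^+ 2)).
    rewrite ler_wpM2l// -[(s - t) ^+ 2]real_normK ?num_real// lerXn2r ?nnegrE//.
    by rewrite ltW// divr_gt0.
  by rewrite lerDr ltW.
move=> N _ hN; exists N%:R => // s t s01 t01.
by apply: (hN N) => //=; rewrite in_itv.
Unshelve. all: by end_near. Qed.

Lemma weierstrass01 h (e : R) : continuous h -> 0 < e ->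
  exists p : {poly R}, forall x, 0 <= x <= 1 -> `|h x - p.[x]| <= e.
Proof.
move=> ch e0; have e20 : 0 < e / 2 by rewrite divr_gt0.
have [K K0 hK] := quadratic_modulus ch e20.
pose n := (Num.truncn (2 * K / e)).+1; have n0 : 0 < n%:R :> R by [].
have Kn : K / n%:R <= e / 2.
  rewrite ler_pdivrMr// mulrC -ler_pdivrMr//.
  apply: ltW; apply: le_lt_trans (truncnS_gt _); rewrite le_eqVlt; apply/orP; left.
  by apply/eqP; field; rewrite gt_eqF.
exists (bernstein n (fun k => h (k%:R / n%:R))) => x x01.
have /andP[x0 x1] := x01.
have err : K * (x * (1 - x) / n%:R) <= e / 2.
  rewrite mulrCA mulrC; apply: le_trans Kn; rewrite -[leRHS]mulr1.
  by apply: ler_wpM2l; [rewrite divr_ge0 | nra].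
(* For s = 1 and s = -1 these are the quadratic majorant and minorant of the sampled h supplied by
   the modulus at x, expanded in powers of k. Their images at x differ from h x by e / 2 plus K
   times the variance x (1 - x) / n. *)
pose q (s : R) k : R := (h x + s * (e / 2) + s * K * x ^+ 2)
  + (- 2 * s * K * x / n%:R) * k%:R + (s * K / n%:R ^+ 2) * k%:R ^+ 2.
have qE s k : q s k = h x + s * (e / 2 + K * (x - k%:R / n%:R) ^+ 2).
  by rewrite /q; field; rewrite gt_eqF.
have qB s : (bernstein n (q s)).[x] =
    h x + s * (e / 2 + K * (x * (1 - x) / n%:R)).
  by rewrite bernstein_quadratic; field; rewrite gt_eqF.
have kn k : (k <= n)%N -> `|h x - h (k%:R / n%:R)| <= e / 2 + K * (x - k%:R / n%:R) ^+ 2.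
  move=> kn; apply: hK => //; rewrite divr_ge0//= ler_pdivrMr// mul1r ler_nat//.
have lo : (bernstein n (q (-1))).[x] <= (bernstein n (fun k => h (k%:R / n%:R))).[x].
  by apply: bernstein_le => // k /kn; rewrite qE ler_norml => /andP[h1 h2]; lra.
have hi : (bernstein n (fun k => h (k%:R / n%:R))).[x] <= (bernstein n (q 1)).[x].
  by apply: bernstein_le => // k /kn; rewrite qE ler_norml => /andP[h1 h2]; lra.
rewrite !qB in lo hi; rewrite ler_norml; apply/andP; split; lra.
Qed.

Lemma weierstrass h (e M : R) : continuous h -> 0 < e -> 0 < M ->
  exists p : {poly R}, forall x, 0 <= x <= M -> `|h x - p.[x]| <= e.
Proof.
move=> ch e0 M0.
have ch' : continuous (fun t => h (M * t)).
  by move=> t; apply: (@continuous_comp _ _ _ (fun t : R => M * t) h); [exact: mulrl_continuous | exact: ch].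
have [p hp] := weierstrass01 ch' e0.
exists (p \Po (M^-1 *: 'X)) => x /andP[x0 xM].
have := hp (M^-1 * x); rewrite mulrA divff ?gt_eqF// mul1r horner_comp !hornerE.
by apply; rewrite mulrC divr_ge0 ?(ltW M0)//= ler_pdivrMr ?mul1r.
Qed.

End Weierstrass.

(** * Measures on the plane *)

Section PlaneMeasures.
Variable R : realType.

(** The plane carries the product sigma-algebra, so an open preimage is written as a countable union
    of boxes with rational centres and radii 1 / (n + 1); boxes that leave the set are replaced by
    the empty set. *)
Lemma continuous_plane_measurable (f : R * R -> R) : continuous f ->
  measurable_fun setT f.
Proof.
move=> cf; apply: (measurability _ (RGenOpens.measurableE R)).
move=> _ [_ [a [b ->] <-]]; rewrite setTI.
set U := f @^-1` _.
have oU : open U by move/continuousP : cf; apply; exact: interval_open.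
pose box (q q' : rat) (n : nat) : set (R * R) :=
  ball (ratr q : R) n.+1%:R^-1 `*` ball (ratr q' : R) n.+1%:R^-1.
pose B q q' n := if `[< box q q' n `<=` U >] then box q q' n else set0.
have -> : U = \bigcup_q \bigcup_q' \bigcup_n B q q' n.
  apply/seteqP; split; last first.
    by move=> z [q _ [q' _ [n _]]]; rewrite /B; case: asboolP => // h; exact: h.
  move=> [x y] Uxy.
  have /nbhs_ballP[e /= e0 hU] : nbhs (x, y) U by exact: open_nbhs_nbhs.
  pose n := Num.truncn (2 / e).
  have ne : n.+1%:R^-1 < e / 2 :> R.
    rewrite invf_plt ?posrE ?divr_gt0// invf_div; exact: truncnS_gt.
  have n0 : 0 < n.+1%:R^-1 :> R by [].
  have [d dE] : exists d : R, d = n.+1%:R^-1 by eexists.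
  rewrite -dE in ne n0.
  have near (w : R) : exists q : rat, w - d < ratr q < w + d.
    have [|q] := @rat_in_itvoo R (w - d) (w + d); first by lra.
    by rewrite in_itv => qw; exists q.
  have [q /andP[q1 q2]] := near x.
  have [q' /andP[q1' q2']] := near y.
  exists q => //; exists q' => //; exists n => //.
  have bx : box q q' n (x, y).
    by split; rewrite /= /ball /= -dE ltr_norml; apply/andP; split; lra.
  rewrite /B; case: asboolP => // h; exfalso; apply: h => -[x' y'] [/= hx hy].
  apply: hU; split => /=; rewrite /ball /= -dE in hx hy *;
    move: hx hy; rewrite !ltr_norml => /andP[h1 h2] /andP[h3 h4]; apply/andP; split; lra.
apply: bigcupT_measurable_rat => q; apply: bigcupT_measurable_rat => q'.
apply: bigcupT_measurable => n; rewrite /B; case: asboolP => // _.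
by apply: measurableX; exact: measurable_ball.
Qed.

Lemma Rintegral_mscale_msum_dirac d (T : measurableType d) (k : {nonneg R})
    (z : nat -> T) N (f : T -> R) : measurable_fun setT f ->
  (\int[mscale k (msum (fun j => \d_(z j)) N)]_x f x)%R =
  k%:num * \sum_(j < N) f (z j).
Proof.
move=> mf.
have ge0 (g : T -> \bar R) : measurable_fun setT g -> (forall x, (0 <= g x)%E) ->
    (\int[mscale k (msum (fun j => \d_(z j)) N)]_x g x =
     k%:num%:E * \sum_(j < N) g (z j))%E.
  move=> mg g0; rewrite ge0_integral_mscale// ge0_integral_measure_sum//.
  congr (_ * _)%E; apply: eq_bigr => j _.
  by rewrite integral_dirac// diracT mul1e.
rewrite /Rintegral integralE !ge0//; last 2 first.
- by apply: measurable_funeneg; exact/measurable_EFinP.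
- by apply: measurable_funepos; exact/measurable_EFinP.
rewrite (eq_bigr (fun j : 'I_N => (Num.max (f (z j)) 0)%:E)); last first.
  by move=> j _; rewrite funeposE -EFin_max.
rewrite [X in (_ - _ * X)%E](eq_bigr (fun j : 'I_N => (Num.max (- f (z j)) 0)%:E)); last first.
  by move=> j _; rewrite funenegE -EFin_max.
rewrite !sumEFin -!EFinM -EFinB /= -mulrBr -sumrB; congr (_ * _).
apply: eq_bigr => j _; have [h|h] := leP 0 (f (z j)).
  by rewrite (max_r (_ : - f (z j) <= 0)) ?oppr_le0// subr0.
by rewrite (max_l (_ : 0 <= - f (z j))) ?oppr_ge0 ?ltW// sub0r opprK.
Qed.

End PlaneMeasures.

(** * Nondecreasing functions on the unit interval and their laws *)

Section MonotoneMeasure.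
Variable R : realType.
Notation mu := (@lebesgue_measure R).
Implicit Types (phi X : R -> R).

(** Monotonicity encloses the integral between the left and right sums, whose difference telescopes.
    The error depends on phi through B only, hence is uniform over all the quantile functions
    below. *)
Lemma riemann_nondecreasing phi (B : R) K : {homo phi : x y / x <= y} ->
  (forall x, 0 <= phi x <= B) -> (0 < K)%N ->
  `|(\int[uniform_prob (@ltr01 R)]_t phi t)%R -
    K%:R^-1 * \sum_(j < K) phi (j%:R / K%:R)| <= B / K%:R.
Proof.
move=> hphi phiB K0; have K0' : 0 < K%:R :> R by rewrite ltr0n.
have mphi : measurable_fun setT phi by exact: nondecreasing_measurable.
have mE D : measurable_fun D (EFin \o phi) by apply/measurable_EFinP/measurable_funTS.
have phi0 x : (0 <= (phi x)%:E)%E by rewrite lee_fin; case/andP: (phiB x).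
pose J (n : nat) := (\int[mu]_(t in `[0%R, (n%:R / K%:R)%R]) (phi t)%:E)%E.
have step n : ((K%:R^-1 * phi (n%:R / K%:R))%:E + J n <= J n.+1)%E /\
    (J n.+1 <= (K%:R^-1 * phi (n.+1%:R / K%:R))%:E + J n)%E.
  have le1 : n%:R / K%:R <= n.+1%:R / K%:R :> R.
    by rewrite ler_pM2r ?invr_gt0// ler_nat.
  have le0 : 0 <= n%:R / K%:R :> R by rewrite divr_ge0.
  have -> : J n.+1 = ((\int[mu]_(t in `](n%:R / K%:R)%R, (n.+1%:R / K%:R)%R]) (phi t)%:E) + J n)%E.
    rewrite addeC -ge0_integral_setU//=.
    - by rewrite -itv_bndbnd_setU// bnd_simp.
    - exact: mE.
    - apply/disj_setPS => t [/=]; rewrite !in_itv/= => /andP[_ t1] /andP[t2 _].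
      by move: (le_lt_trans t1 t2); rewrite ltxx.
  have meas : (mu `](n%:R / K%:R)%R, (n.+1%:R / K%:R)%R] = (K%:R^-1)%:E)%E.
    rewrite lebesgue_measure_itv /= lte_fin ltr_pM2r ?invr_gt0// ltr_nat ltnSn.
    by rewrite -EFinB -mulrBl -natrB// subSnn mul1r.
  have cstI (r : R) : (\int[mu]_(t in `](n%:R / K%:R)%R, (n.+1%:R / K%:R)%R]) r%:E =
      (K%:R^-1 * r)%:E)%E.
    by rewrite integral_cst//= [X in (_ * X)%E]meas -EFinM mulrC.
  split; rewrite leeD2r// -cstI; apply: ge0_le_integral => //.
  - exact: mE.
  - by move=> t /=; rewrite in_itv/= => /andP[t1 _]; rewrite lee_fin hphi// ltW.
  - exact: mE.
  - by move=> t /=; rewrite in_itv/= => /andP[_ t1]; rewrite lee_fin hphi.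
have J0 : J 0%N = 0%E by rewrite /J mul0r set_itv1 integral_set1.
have bnd n : ((K%:R^-1 * \sum_(j < n) phi (j%:R / K%:R))%:E <= J n)%E /\
    (J n <= (K%:R^-1 * \sum_(j < n) phi (j.+1%:R / K%:R))%:E)%E.
  elim: n => [|n [IH1 IH2]]; first by rewrite !big_ord0 mulr0 J0.
  have [s1 s2] := step n; rewrite !big_ord_recr /= !mulrDr !EFinD; split.
    by apply: le_trans s1; rewrite addeC leeD2l.
  by apply: (le_trans s2); rewrite [leRHS]addeC leeD2l.
have [b1 b2] := bnd K.
have -> : (\int[uniform_prob (@ltr01 R)]_t phi t)%R = fine (J K).
  rewrite /Rintegral integral_uniform//; last exact: mE.
  by rewrite subr0 invr1 mul1e /J divff ?gt_eqF.
have JK : J K \is a fin_num by rewrite fin_real// (lt_le_trans _ b1) ?ltNyr//= (le_lt_trans b2) ?ltry.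
move: b1 b2; rewrite -(fineK JK) !lee_fin /= => b1 b2.
have tel : K%:R^-1 * \sum_(j < K) phi (j.+1%:R / K%:R) -
    K%:R^-1 * \sum_(j < K) phi (j%:R / K%:R) <= B / K%:R.
  rewrite -mulrBr -sumrB mulrC ler_pM2r ?invr_gt0//.
  rewrite -(big_mkord xpredT (fun j => phi (j.+1%:R / K%:R) - phi (j%:R / K%:R))).
  rewrite telescope_sumr// lerBlDr; apply: (le_trans (_ : _ <= B)).
    by case/andP: (phiB (K%:R / K%:R)).
  by rewrite lerDl; case/andP: (phiB (0%:R / K%:R)).
by rewrite ler_norml; apply/andP; split; lra.
Qed.

(** The law of (X t, 0) for t uniform on [0, 1]; monotonicity makes X measurable. *)
Lemma axis_probability X : {homo X : x y / x <= y} ->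
  exists nu : probability (R * R)%type R, forall f : R * R -> R,
    continuous f -> (exists M : R, forall z, `|f z| <= M) ->
    (\int[nu]_z f z)%R = (\int[uniform_prob (@ltr01 R)]_t f (X t, 0))%R.
Proof.
move=> hX.
have mX : measurable_fun setT (fun t : measurableTypeR R => (X t, 0 : R)).
  by apply/measurable_fun_pairP; split => //=; exact: nondecreasing_measurable.
pose Y := mfun_Sub (mem_set mX).
exists (distribution (uniform_prob (@ltr01 R)) Y) => f cf [M fM].
have mf := continuous_plane_measurable cf.
rewrite /Rintegral integral_distribution//; first exact/measurable_EFinP.
apply: (@measurable_bounded_integrable _ _ _ _ (f \o Y)) => //=.
- by rewrite probability_setT ltry.
- by apply: measurableT_comp => //.
- by exists M; split; rewrite ?num_real// => x Mx t _ /=; rewrite (le_trans (fM _))// ltW.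
Qed.

Lemma ultra_bounded_cvg (U : set_system nat) (x : nat -> R) (a b : R) :
  UltraFilter U -> (\forall m \near U, a <= x m <= b) -> exists l : R, x @ U --> l.
Proof.
move=> UU xab.
have PF : ProperFilter (x @ U) by apply: fmap_proper_filter.
have := @segment_compact R a b (x @ U) PF _.
case.
  by apply: filterS xab => m; rewrite /= in_itv.
move=> l [_ lcl]; exists l => V Vl.
have [//|h] := in_ultra_setVsetC (x @^-1` V) UU.
have [y [Vy]] := lcl (~` V) V h Vl.
by [].
Qed.

End MonotoneMeasure.

Lemma cvg_sumr (K : numFieldType) (V : normedModType K) (T I : Type)
    (F : set_system T) (r : seq I) (f : I -> T -> V) (l : I -> V) : Filter F ->
  (forall i, f i x @[x --> F] --> l i) ->
  \sum_(i <- r) f i x @[x --> F] --> \sum_(i <- r) l i.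
Proof. by move=> FF fl; apply: cvg_big => //; exact: add_continuous. Qed.

(** * Convergence of moments and weak limits *)

Section WeakLimit.
Variables (R : realType) (vs : nat -> seq R) (M : R).
Hypothesis M_gt0 : 0 < M.
Hypothesis vs_oo : (fun m => size (vs m)) @ \oo --> \oo.
Hypothesis vs_bound : \forall m \near \oo, all (fun v => 0 <= v <= M) (vs m).

Definition avg (s : seq R) (g : R -> R) : R :=
  (size s)%:R^-1 * \sum_(v <- s) g v.

Lemma avgD s g h : avg s (fun v => g v + h v) = avg s g + avg s h.
Proof. by rewrite /avg big_split mulrDr. Qed.

Lemma avgZ s (a : R) g : avg s (fun v => a * g v) = a * avg s g.
Proof. by rewrite /avg -mulr_sumr mulrCA. Qed.

Lemma eq_avg s g h : (forall v, v \in s -> g v = h v) -> avg s g = avg s h.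
Proof. by move=> gh; rewrite /avg; congr (_ * _); exact: eq_big_seq. Qed.

Lemma avg_norm_le s g (B : R) : 0 <= B -> (forall v, v \in s -> `|g v| <= B) ->
  `|avg s g| <= B.
Proof.
move=> B0 gB; rewrite /avg normrM ger0_norm ?invr_ge0//.
have h : `|\sum_(v <- s) g v| <= (size s)%:R * B.
  apply: (le_trans (ler_norm_sum _ _ _)).
  rewrite big_seq; apply: (le_trans (ler_sum _ gB)).
  by rewrite -big_seq big_const_seq count_predT iter_addr_0 mulr_natl.
case: (posnP (size s)) => [s0|s0]; first by rewrite s0 invr0 mul0r.
by rewrite mulrC ler_pdivrMr ?ltr0n// mulrC.
Qed.

Lemma approx_is_cvg (F : set_system nat) (x : nat -> R) : ProperFilter F ->
  (forall e, 0 < e -> exists2 y : nat -> R, cvg (y @ F) &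
     \forall m \near F, `|x m - y m| <= e) -> cvg (x @ F).
Proof.
move=> PF h; apply/cauchy_cvgP/cauchy_exP => e /= e0.
have [y /cvg_ex[/= l yl] xy] := h (e / 3) ltac:(by rewrite divr_gt0).
exists l.
move/cvgrPdist_lt/(_ (e / 3) ltac:(by rewrite divr_gt0)) : yl => yl.
near=> m; rewrite /= /ball /=.
have h1 : `|l - y m| < e / 3 by near: m.
have h2 : `|x m - y m| <= e / 3 by near: m.
have -> : l - x m = (l - y m) - (x m - y m) by ring.
by apply: (le_lt_trans (ler_normB _ _)); lra.
Unshelve. all: by end_near. Qed.

Section Moments.
Variable M' : R.
Hypothesis stieltjes_cvg : forall u, M' < u ->
  cvg (avg (vs m) (fun v => (u - v)^-1) @[m --> \oo]).

(** As u grows, u v^k / (u - v) tends to v^k uniformly on [0, M], the difference being v^(k + 1) /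
    (u - v). *)
Lemma moment_step k :
  (forall u, Num.max M M' < u ->
     cvg (avg (vs m) (fun v => v ^+ k / (u - v)) @[m --> \oo])) ->
  cvg (avg (vs m) (fun v => v ^+ k) @[m --> \oo]).
Proof.
move=> hk; apply: approx_is_cvg => e e0.
pose C := M ^+ k.+1; have C0 : 0 < C by exact: exprn_gt0.
(* This makes u - v larger than M^(k + 1) / e for every v in [0, M]. *)
pose u := Num.max M M' + 1 + C / e.
have uM : M + C / e < u.
  rewrite /u ltrD2r (le_lt_trans (_ : _ <= Num.max M M')) ?le_max ?lexx// ltrDl//.
have uM' : Num.max M M' < u by rewrite /u -addrA ltrDl addr_gt0// divr_gt0.
exists (fun m => u * avg (vs m) (fun v => v ^+ k / (u - v))).
  by apply: is_cvgMr; exact: hk.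
near=> m.
have vm : all (fun v => 0 <= v <= M) (vs m) by near: m.
have uv v : v \in vs m -> C / e < u - v.
  by move=> /(allP vm) /andP[_ vM]; lra.
rewrite -avgZ -mulN1r -avgZ -avgD.
apply: avg_norm_le; first exact: ltW.
move=> v vin; have uv0 := uv v vin; have /andP[v0 vM] := allP vm v vin.
have Ce : 0 < C / e by rewrite divr_gt0.
have -> : v ^+ k + -1 * (u * (v ^+ k / (u - v))) = - (v ^+ k.+1 / (u - v)).
  by rewrite exprS; field; rewrite gt_eqF// (lt_trans Ce).
rewrite normrN ger0_norm; last by rewrite divr_ge0 ?exprn_ge0// ltW// (lt_trans Ce).
rewrite ler_pdivrMr ?(lt_trans Ce)//; apply: (@le_trans _ _ C).
  by rewrite lerXn2r ?nnegrE// ltW.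
by rewrite mulrC -ler_pdivrMr// ltW.
Unshelve. all: by end_near. Qed.

(** Induction on v^(k + 1) / (u - v) = u v^k / (u - v) - v^k, the last term being handled by
    [moment_step]. *)
Lemma stieltjes_moment_cvg k u : Num.max M M' < u ->
  cvg (avg (vs m) (fun v => v ^+ k / (u - v)) @[m --> \oo]).
Proof.
elim: k u => [|k IH] u uM.
  under eq_fun do under eq_fun do rewrite expr0 mul1r.
  by apply: stieltjes_cvg; rewrite (le_lt_trans _ uM)// le_max lexx orbT.
have h1 := IH u uM; have h2 := moment_step IH.
have h3 : cvg (u * avg (vs m) (fun v => v ^+ k / (u - v)) -
    avg (vs m) (fun v => v ^+ k) @[m --> \oo]).
  by apply: is_cvgB => //; exact: is_cvgMr.
apply: approx_is_cvg => e e0; eexists; first exact: h3.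
near=> m.
have vm : all (fun v => 0 <= v <= M) (vs m) by near: m.
rewrite -avgZ -[- avg _ _]mulN1r -avgZ -avgD.
rewrite [X in `|X - _|](@eq_avg _ _ (fun v => u * (v ^+ k / (u - v)) + -1 * v ^+ k)).
  by rewrite subrr normr0 ltW.
move=> v /(allP vm) /andP[_ vM].
rewrite exprS; field; rewrite gt_eqF// subr_gt0 (le_lt_trans vM)//.
by rewrite (le_lt_trans _ uM)// le_max lexx.
Unshelve. all: by end_near. Qed.

Lemma moment_cvg k : cvg (avg (vs m) (fun v => v ^+ k) @[m --> \oo]).
Proof. by apply: moment_step => u; exact: stieltjes_moment_cvg. Qed.

End Moments.

(** Capping the index keeps the function nondecreasing and bounded on the whole line, as
    [riemann_nondecreasing] asks, and covers t = 1. *)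
Definition quantile (s : seq R) (t : R) : R :=
  nth 0 (sort <=%R s) (minn (Num.truncn (t * (size s)%:R)) (size s).-1).

Lemma quantile_ndecr s : {homo quantile s : x y / x <= y}.
Proof.
move=> x y xy; rewrite /quantile.
case: (posnP (size s)) => [/size0nil ->|s0]; first by rewrite !nth_nil.
apply: (sorted_leq_nth le_trans le_refl) => //.
- exact/sort_le_sorted.
- by rewrite inE size_sort gtn_min orbC ltn_predL s0.
- by rewrite inE size_sort gtn_min orbC ltn_predL s0.
rewrite leq_min geq_minr andbT geq_min; apply/orP; left.
by apply: le_truncn; rewrite ler_wpM2r.
Qed.

Lemma quantile_bound s t : all (fun v => 0 <= v <= M) s -> 0 <= quantile s t <= M.
Proof.
move=> sM; rewrite /quantile.
case: (posnP (size s)) => [/size0nil ->|s0]; first by rewrite nth_nil lexx ltW.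
apply: (allP sM); rewrite -(mem_sort <=%R) mem_nth//.
by rewrite size_sort gtn_min orbC ltn_predL s0.
Qed.

Lemma avg_quantile s (g : R -> R) :
  avg s g = (size s)%:R^-1 * \sum_(j < size s) g (quantile s (j%:R / (size s)%:R)).
Proof.
rewrite /avg; congr (_ * _).
rewrite -(perm_big _ (permEl (perm_sort <=%R s))) /= (big_nth 0) big_mkord size_sort.
apply: eq_bigr => j _; rewrite /quantile; congr (g (nth _ _ _)).
have s0 : (0 < size s)%N by exact: leq_ltn_trans (ltn_ord j).
rewrite divfK ?pnatr_eq0 ?gt_eqF// natrK.
by apply/esym/minn_idPl; rewrite -ltnS prednK.
Qed.

(** By [avg_quantile] the average is itself a Riemann sum, with one cell per point; it is compared
    with the sum over K cells through the common integral. *)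
Lemma riemann_quantile_power s k K : all (fun v => 0 <= v <= M) s ->
  (0 < size s)%N -> (0 < K)%N ->
  `|avg s (fun v => v ^+ k) -
    K%:R^-1 * \sum_(j < K) quantile s (j%:R / K%:R) ^+ k|
  <= M ^+ k / (size s)%:R + M ^+ k / K%:R.
Proof.
move=> sM s0 K0.
have nd : {homo (fun t => quantile s t ^+ k) : x y / x <= y}.
  move=> x y xy; have /andP[q0 _] := quantile_bound x sM.
  have h := quantile_ndecr s xy.
  by rewrite lerXn2r ?nnegrE// (le_trans q0).
have bd t : 0 <= quantile s t ^+ k <= M ^+ k.
  have /andP[q0 q1] := quantile_bound t sM.
  by rewrite exprn_ge0//= lerXn2r ?nnegrE// ltW.
have := riemann_nondecreasing nd bd K0; have := riemann_nondecreasing nd bd s0.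
rewrite -(avg_quantile s (fun v => v ^+ k)).
set I := (\int[_]_t _)%R; set S := _ * \sum_(_ < _) _; set a := avg _ _ => h1 h2.
have -> : a - S = (I - S) - (I - a) by ring.
by apply: (le_trans (ler_normB _ _)); lra.
Qed.

(** A form of Helly selection: an ultrafilter gives pointwise limits of the quantile functions at
    all t at once. A Riemann sum with fixed K involves finitely many points and so passes to the
    limit. *)
Lemma ultra_moment_limit (U : set_system nat) : UltraFilter U -> \oo `<=` U ->
  exists X : R -> R, [/\ {homo X : x y / x <= y}, forall t, 0 <= X t <= M &
    forall k, avg (vs m) (fun v => v ^+ k) @[m --> U] -->
      (\int[uniform_prob (@ltr01 R)]_t X t ^+ k)%R].
Proof.
move=> UU ooU.
have vsU : \forall m \near U, all (fun v => 0 <= v <= M) (vs m) by exact: ooU.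
have sU K : \forall m \near U, (K <= size (vs m))%N.
  by apply: ooU; exact: (vs_oo (nbhs_infty_ge K)).
have qU t : \forall m \near U, 0 <= quantile (vs m) t <= M.
  by apply: filterS vsU => m; exact: quantile_bound.
have [X hX] := choice (fun t => ultra_bounded_cvg UU (qU t)).
have Xnd : {homo X : x y / x <= y}.
  move=> x y xy; apply: ler_cvg_to (hX x) (hX y) _.
  by apply: nearW => m; exact: quantile_ndecr.
have hc (b : R) : (fun=> b) @ U --> b by exact: cvg_cst.
have XB t : 0 <= X t <= M.
  apply/andP; split.
    apply: ler_cvg_to (hc 0) (hX t) _.
    by apply: filterS (qU t) => m /andP[].
  apply: ler_cvg_to (hX t) (hc M) _.
  by apply: filterS (qU t) => m /andP[].
exists X; split => // k.
have nd : {homo (fun t => X t ^+ k) : x y / x <= y}.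
  by move=> x y xy; rewrite lerXn2r ?nnegrE ?Xnd//; [case/andP: (XB x)|case/andP: (XB y)].
have bd t : 0 <= X t ^+ k <= M ^+ k.
  have /andP[q0 q1] := XB t.
  by rewrite exprn_ge0//= lerXn2r ?nnegrE// ltW.
apply/cvgrPdist_le => e e0; set I := (\int[_]_t _)%R.
have B0 : 0 < M ^+ k by exact: exprn_gt0.
(* The error has four parts of at most e / 4: one for discretizing X, one for the limit of the
   K-point sums, and the two terms of [riemann_quantile_power]. *)
pose K := (Num.truncn (4 * M ^+ k / e)).+1.
have K0 : 0 < K%:R :> R by [].
have KB : M ^+ k / K%:R <= e / 4.
  rewrite ler_pdivrMr// mulrC -ler_pdivrMr ?divr_gt0// invf_div mulrA.
  by rewrite [M ^+ k * 4]mulrC ltW// truncnS_gt.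
have SK : K%:R^-1 * \sum_(j < K) quantile (vs m) (j%:R / K%:R) ^+ k @[m --> U] -->
    K%:R^-1 * \sum_(j < K) X (j%:R / K%:R) ^+ k.
  apply: cvgMr; apply: cvg_sumr => j.
  apply: (@cvg_comp _ _ _ _ (fun x : R => x ^+ k) _ _ _ (hX _)).
  exact: exprn_continuous.
have h1 := riemann_nondecreasing nd bd (ltn0Sn _ : (0 < K)%N); rewrite -/I in h1.
move/cvgrPdist_le/(_ _ (divr_gt0 e0 (ltr0n R 4))) : SK => SK.
near=> m.
have vm : all (fun v => 0 <= v <= M) (vs m) by near: m.
have sm : (K <= size (vs m))%N by near: m; exact: sU.
have s0 : (0 < size (vs m))%N by exact: leq_trans sm.
have h2 := riemann_quantile_power k vm s0 (ltn0Sn _ : (0 < K)%N).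
have h3 : `|K%:R^-1 * \sum_(j < K) X (j%:R / K%:R) ^+ k -
  K%:R^-1 * \sum_(j < K) quantile (vs m) (j%:R / K%:R) ^+ k| <= e / 4 by near: m.
have h4 : M ^+ k / (size (vs m))%:R <= e / 4.
  apply: le_trans KB; rewrite ler_pM2l// lef_pV2 ?posrE ?ltr0n// ler_nat//.
move: h1 h2 h3; set a := avg _ _; set S := _ * \sum_(_ < _) X _ ^+ _; set S' := _ * \sum_(_ < _) _ => h1 h2 h3.
have -> : I - a = (I - S) + (S - S') - (a - S') by ring.
apply: (le_trans (ler_normB _ _)); have := ler_normD (I - S) (S - S'); lra.
Unshelve. all: by end_near. Qed.

(** The ultrafilter serves to exhibit a measure; since the moments converge along [\oo], their
    limits there are the moments of that measure. Polynomial approximation on [0, M] then passes to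
    continuous functions. *)
Theorem moment_weak_limit :
  (forall k, cvg (avg (vs m) (fun v => v ^+ k) @[m --> \oo])) ->
  exists nu : probability (R * R)%type R, forall f : R * R -> R,
    continuous f -> (exists B : R, forall z, `|f z| <= B) ->
    avg (vs m) (fun v => f (v, 0)) @[m --> \oo] --> (\int[nu]_z f z)%R.
Proof.
move=> mcvg.
have [U [UU ooU]] := ultraFilterLemma (_ : ProperFilter \oo).
have [X [Xnd XB XM]] := ultra_moment_limit UU ooU.
have [nu nuE] := axis_probability Xnd.
pose P : probability (measurableTypeR R) R := uniform_prob (@ltr01 R).
have PT : P setT = 1%E := probability_setT P.
have mX : measurable_fun setT (X : measurableTypeR R -> R) by exact: nondecreasing_measurable.
have XcM k : avg (vs m) (fun v => v ^+ k) @[m --> \oo] --> (\int[P]_t X t ^+ k)%R.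
  have /cvg_ex[l hl] := mcvg k.
  have hU : avg (vs m) (fun v => v ^+ k) @[m --> U] --> l by apply: cvg_trans hl; exact: cvg_app.
  by rewrite -(cvg_unique _ hU (XM k)).
have XB' t : X t \in `[0, M] by rewrite in_itv/=; exact: XB.
have intX (g : R -> R) : continuous g -> P.-integrable setT (EFin \o (g \o X)).
  move=> cg; have mg := continuous_measurable_fun cg.
  have cg' : {within `[0, M], continuous (fun t => `|g t|)}.
    by apply: continuous_subspaceT => t; apply: cvg_norm; exact: cg.
  have [d _ hd] := EVT_max (ltW M_gt0) cg'.
  apply: measurable_bounded_integrable => //.
  - by move: (ltry (1 : R)); rewrite -PT.
  - exact: measurableT_comp.
  - exists `|g d|; split; rewrite ?num_real// => x Bx t _ /=.
    by rewrite (le_trans (hd _ (XB' t)))// ltW.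
have polyc n (a : nat -> R) : continuous (fun v : R => \sum_(i < n) a i * v ^+ i) /\
    avg (vs m) (fun v => \sum_(i < n) a i * v ^+ i) @[m --> \oo] -->
    (\int[P]_t \sum_(i < n) a i * X t ^+ i)%R.
  have cX i : continuous (fun v : R => a i * v ^+ i).
    by move=> v; apply: cvgMr; exact: exprn_continuous.
  elim: n => [|n [IH1 IH2]]; split.
  - under eq_fun do rewrite big_ord0; exact: cst_continuous.
  - under eq_fun do under eq_fun do rewrite big_ord0.
    under eq_Rintegral do rewrite big_ord0.
    rewrite Rintegral_cst// mul0r; under eq_fun do rewrite /avg big1// mulr0.
    exact: cvg_cst.
  - under eq_fun do rewrite big_ord_recr /=.
    by move=> v; apply: cvgD; [exact: IH1|exact: cX].
  - rewrite (_ : (fun m => avg (vs m) _) = (fun m =>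
        avg (vs m) (fun v => \sum_(i < n) a i * v ^+ i) +
        a n * avg (vs m) (fun v => v ^+ n))); last first.
      apply/funext => m; rewrite -avgZ -avgD; apply: eq_avg => v _.
      by rewrite big_ord_recr.
    under eq_Rintegral do rewrite big_ord_recr /=.
    rewrite RintegralD//; last 2 first.
    + exact: (intX _ IH1).
    + exact: (intX _ (cX n)).
    rewrite RintegralZl//; last exact: (intX _ (@exprn_continuous _ n)).
    by apply: cvgD => //; apply: cvgMr; exact: XcM.
exists nu => f cf fb; rewrite nuE//.
pose g v := f (v, 0).
have cg : continuous g.
  move=> v; apply: (@continuous_comp _ _ _ (fun v : R => (v, 0 : R)) f); last exact: cf.
  move=> B [[B1 B2] /= [hB1 hB2] hB]; apply: filterS hB1 => w Bw.
  by apply: hB; split => //=; exact: nbhs_singleton.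
apply/cvgrPdist_le => e e0; have e30 : 0 < e / 3 by rewrite divr_gt0.
have [p hp] := weierstrass cg e30 M_gt0.
have [cp limp] := polyc (size p) (fun i => p`_i).
set q := (fun v : R => \sum_(i < size p) p`_i * v ^+ i) in cp limp.
have qE v : q v = p.[v] by rewrite horner_coef.
have h1 : `|(\int[P]_t g (X t))%R - (\int[P]_t q (X t))%R| <= e / 3.
  rewrite -RintegralB//; [|exact: (intX _ cg)|exact: (intX _ cp)].
  have cgq : continuous (fun v => g v - q v).
    by move=> v; apply: cvgB; [exact: cg|exact: cp].
  apply: (le_trans (le_normr_Rintegral _ (intX _ cgq))) => //.
  apply: (@le_trans _ _ (\int[P]_t (e / 3))%R).
    apply: le_Rintegral => //.
    - exact/integrable_norm/(intX _ cgq).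
    - exact: (intX _ (@cst_continuous _ _ (e / 3))).
    - by move=> t _; rewrite /= qE; exact: hp.
  rewrite Rintegral_cst//; apply: (@le_trans _ _ (e / 3 * fine (1%E : \bar R))).
    by rewrite -PT.
  by rewrite mulr1.
move/cvgrPdist_le/(_ _ e30) : limp => limp.
near=> m.
have vm : all (fun v => 0 <= v <= M) (vs m) by near: m.
have h2 : `|(\int[P]_t q (X t))%R - avg (vs m) q| <= e / 3 by near: m.
have h3 : `|avg (vs m) q - avg (vs m) g| <= e / 3.
  rewrite -mulN1r -avgZ -avgD; apply: avg_norm_le; first exact: ltW.
  by move=> v /(allP vm) vM; rewrite mulN1r qE distrC; exact: hp.
set I := (\int[P]_t g (X t))%R in h1 *.
have -> : I - avg (vs m) (fun v => f (v, 0)) = (I - (\int[P]_t q (X t))%R) +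
  ((\int[P]_t q (X t))%R - avg (vs m) q) + (avg (vs m) q - avg (vs m) g) by rewrite /g; ring.
apply: (le_trans (ler_normD _ _)).
by have := ler_normD (I - (\int[P]_t q (X t))%R) ((\int[P]_t q (X t))%R - avg (vs m) q); lra.
Unshelve. all: by end_near. Qed.

End WeakLimit.

(** * Logarithmic derivatives off the zeros *)

Section ComplexBounds.
Variable R : realType.
Implicit Types (u z w : R[i]) (zs ws s : seq R) (x g a b am K : R).
Local Notation nc := (@ComplexField.Normc.normc R).
Local Notation C := (real_complex R).

Lemma normc_real x : nc x%:C = `|x|.
Proof. by rewrite /= expr0n addr0 sqrtr_sqr. Qed.

Lemma normc_norm z : `|z| = (nc z)%:C.
Proof. by case: z => p q; rewrite normc_def. Qed.

Lemma normc_ge0 z : 0 <= nc z.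
Proof. by case: z => p q; exact: sqrtr_ge0. Qed.

Lemma normcX z n : nc (z ^+ n) = nc z ^+ n.
Proof.
elim: n => [|n IH]; first by rewrite !expr0 ComplexField.Normc.normc1.
by rewrite !exprS ComplexField.Normc.normcM IH.
Qed.

Lemma normcB_ge z w : nc z - nc w <= nc (z - w).
Proof. by rewrite lerBlDr; have := le_normcD (z - w) w; rewrite subrK. Qed.

Lemma normc_gt0_neq0 z : 0 < nc z -> z != 0.
Proof. by apply: contraTneq => ->; rewrite ComplexField.Normc.normc0 ltxx. Qed.

Lemma le_normcB z w : nc (z - w) <= nc z + nc w.
Proof. by have := le_normcD z (- w); rewrite normcN. Qed.

Lemma le_normc_sum (I : Type) (r : seq I) (f : I -> R[i]) :
  nc (\sum_(i <- r) f i) <= \sum_(i <- r) nc (f i).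
Proof.
elim: r => [|i r IH]; first by rewrite !big_nil ComplexField.Normc.normc0.
by rewrite !big_cons (le_trans (le_normcD _ _))// lerD2l.
Qed.

Lemma normc_natM N u : nc (N%:R * u) = N%:R * nc u.
Proof.
by rewrite ComplexField.Normc.normcM -(rmorph_nat C) normc_real ger0_norm.
Qed.

Lemma map_lagp (F G : fieldType) (f : {rmorphism F -> G}) (g : F)
    (s0 : seq F) :
  map_poly f (lagp g s0) = lagp (f g) (map f s0).
Proof.
elim: s0 => [|a s0 IH] /=; first by rewrite rmorph1.
by rewrite map_lag_step IH size_map rmorphB rmorph_nat.
Qed.

Lemma rem_map (T1 T2 : eqType) (f : T1 -> T2) (t : T1) (r : seq T1) :
  injective f -> rem (f t) (map f r) = map f (rem t r).
Proof.
by move=> fI; elim: r => //= y r IH; rewrite (inj_eq fI); case: eqP; rewrite //= IH.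
Qed.

Section Roots.
Variables (N : nat) (u : R[i]) (M0 : R).
Hypotheses (N_gt0 : (0 < N)%N) (u_gt0 : 0 < nc u) (uM0 : 2 * M0 <= nc u).

Let N0 : 0 < N%:R :> R. Proof. by rewrite ltr0n. Qed.

Let bounded zs := all (fun x => 0 < x < N%:R * M0) zs.

Lemma normc_root_dist x : 0 < x < N%:R * M0 ->
  N%:R * nc u / 2 <= nc (N%:R * u - x%:C).
Proof.
case/andP=> x0 xM; apply: le_trans (normcB_ge _ _).
rewrite normc_natM normc_real ger0_norm ?ltW//.
have : N%:R * (2 * M0) <= N%:R * nc u by rewrite ler_pM2l.
lra.
Qed.

Lemma root_dist_gt0 : 0 < N%:R * nc u / 2.
Proof. by rewrite divr_gt0 ?mulr_gt0. Qed.

Lemma root_neq zs z : bounded zs -> z \in map C zs -> N%:R * u != z.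
Proof.
move=> /allP zsB /mapP[y yzs ->]; rewrite -subr_eq0; apply: normc_gt0_neq0.
exact: lt_le_trans root_dist_gt0 (normc_root_dist (zsB _ yzs)).
Qed.

Lemma normc_sum_inv zs : bounded zs ->
  nc (sum_inv (map C zs) (N%:R * u)) <= (size zs)%:R * (2 / (N%:R * nc u)).
Proof.
move=> /allP zsB; apply: (le_trans (le_normc_sum _ _)); rewrite big_map.
apply: (@le_trans _ _ (\sum_(z <- zs) 2 / (N%:R * nc u))); last first.
  by rewrite big_const_seq count_predT iter_addr_0 -[leLHS]mulr_natl.
rewrite big_seq [leRHS]big_seq; apply: ler_sum => z /zsB zB.
rewrite ComplexField.Normc.normcV -invf_div.
by rewrite lef_pV2 ?posrE ?(lt_le_trans root_dist_gt0)// normc_root_dist.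
Qed.

Lemma normc_sum_inv2 zs : bounded zs ->
  nc (sum_inv2 (map C zs) (N%:R * u)) <= (size zs)%:R * (2 / (N%:R * nc u)) ^+ 2.
Proof.
move=> /allP zsB; apply: (le_trans (le_normc_sum _ _)); rewrite big_map.
apply: (@le_trans _ _ (\sum_(z <- zs) (2 / (N%:R * nc u)) ^+ 2)); last first.
  by rewrite big_const_seq count_predT iter_addr_0 -[leLHS]mulr_natl.
rewrite big_seq [leRHS]big_seq; apply: ler_sum => z /zsB zB.
rewrite ComplexField.Normc.normcV normcX -invf_div exprVn.
have h := normc_root_dist zB; have h0 := root_dist_gt0.
rewrite lef_pV2 ?posrE ?exprn_gt0 ?(lt_le_trans h0)//.
by rewrite lerXn2r ?nnegrE ?(ltW h0)// ltW// (lt_le_trans h0).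
Qed.

Variables (am K : R).
Hypotheses (am_gt0 : 0 < am) (u_am : 2 * am * (K + 2) <= nc u).

(* [a Phi] stays in the disc of radius 1/2, so that the two Cauchy transforms
   differ by the logarithmic derivative of a function bounded away from 0. *)
Lemma step_denominator a b ws : 0 < a <= am -> 0 <= b <= K * N%:R ->
  bounded ws -> (size ws <= N)%N ->
  nc (a%:C * (b%:C / (N%:R * u) + sum_inv (map C ws) (N%:R * u))) <= 2^-1.
Proof.
move=> /andP[a0 aam] /andP[b0 bK] wsB wsN.
rewrite ComplexField.Normc.normcM normc_real gtr0_norm//.
set P := nc (_ + _); have P0 : 0 <= P by exact: normc_ge0.
have PK : P <= (K + 2) / nc u.
  apply: (le_trans (le_normcD _ _)).
  rewrite ComplexField.Normc.normcM ComplexField.Normc.normcV normc_real normc_natM.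
  rewrite ger0_norm// mulrDl lerD//.
    by rewrite invfM mulrA ler_wpM2r ?invr_ge0 ?normc_ge0// ler_pdivrMr.
  apply: (le_trans (normc_sum_inv wsB)).
  apply: (@le_trans _ _ (N%:R * (2 / (N%:R * nc u)))).
    by rewrite ler_wpM2r ?ler_nat// divr_ge0// mulr_ge0 ?normc_ge0.
  by rewrite le_eqVlt; apply/orP; left; apply/eqP; field; rewrite !gt_eqF.
apply: (@le_trans _ _ (am * ((K + 2) / nc u))).
  by apply: ler_pM => //; exact: ltW.
rewrite mulrA ler_pdivrMr//; move: u_am; rewrite -mulrA.
by move: (am * _) (nc u) => p q; lra.
Qed.

Lemma step_denominator_neq0 a b ws : 0 < a <= am -> 0 <= b <= K * N%:R ->
  bounded ws -> (size ws <= N)%N ->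
  2^-1 <= nc (1 - a%:C * (b%:C / (N%:R * u) + sum_inv (map C ws) (N%:R * u))).
Proof.
move=> ha hb wsB wsN; have h := step_denominator ha hb wsB wsN.
by apply: le_trans (normcB_ge _ _); rewrite ComplexField.Normc.normc1; lra.
Qed.

(** At x = N u, in [lag_step_log_deriv], the term 1 / x is O(1 / N), b / x^2 is O(1 / N) because b
    is O(N), and [sum_inv2] is a sum of at most N terms of size O(1 / N^2); the denominator costs a
    factor 2. *)
Lemma log_deriv_close a b zs ws : 0 < a <= am -> 0 <= b <= K * N%:R ->
  bounded zs -> bounded ws -> (size ws <= N)%N ->
  prod_roots zs = lag_step b a (prod_roots ws) ->
  nc (sum_inv (map C zs) (N%:R * u) - sum_inv (map C ws) (N%:R * u)) <=
    ((nc u)^-1 + 2 * am * (K + 4) / nc u ^+ 2) / N%:R.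
Proof.
move=> ha hb zsB wsB wsN zwE; have /andP[a0 aam] := ha; have /andP[b0 bK] := hb.
have Nu0 : 0 < nc (N%:R * u) by rewrite normc_natM mulr_gt0.
have zwE' : prod_roots (map C zs) = lag_step b%:C a%:C (prod_roots (map C ws)).
  by rewrite -!map_prod_roots zwE map_lag_step.
rewrite (lag_step_log_deriv (normc_gt0_neq0 Nu0) _ _ zwE'); last 2 first.
- by move=> z; exact: root_neq.
- by move=> z; exact: root_neq.
set w := sum_inv _ _; set W := sum_inv2 _ _; set D := 1 - _.
have -> : forall p q : R[i], w + p + q - w = p + q by move=> p q; ring.
have D2 : 2^-1 <= nc D by exact: step_denominator_neq0.
have D0 : 0 < nc D by lra.
apply: (le_trans (le_normcD _ _)); rewrite mulrDl; apply: lerD.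
  by rewrite ComplexField.Normc.normcV normc_natM invfM mulrC.
rewrite !ComplexField.Normc.normcM ComplexField.Normc.normcV normc_real gtr0_norm//.
set Q := nc (_ + _); have Q0 : 0 <= Q by exact: normc_ge0.
have QK : Q <= (K + 4) / nc u ^+ 2 / N%:R.
  apply: (le_trans (le_normcD _ _)).
  rewrite ComplexField.Normc.normcM ComplexField.Normc.normcV normcX normc_real normc_natM.
  rewrite ger0_norm// mulrDl [leRHS]mulrDl lerD//.
    rewrite ler_pdivrMr ?exprn_gt0 ?mulr_gt0//; apply: (le_trans bK).
    by rewrite le_eqVlt; apply/orP; left; apply/eqP; field; rewrite !gt_eqF.
  apply: (le_trans (normc_sum_inv2 wsB)).
  apply: (@le_trans _ _ (N%:R * (2 / (N%:R * nc u)) ^+ 2)).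
    by rewrite ler_wpM2r ?ler_nat// sqr_ge0.
  by rewrite le_eqVlt; apply/orP; left; apply/eqP; field; rewrite !gt_eqF.
have Dinv : (nc D)^-1 <= 2 by rewrite invf_ple ?posrE.
apply: (@le_trans _ _ (am * ((K + 4) / nc u ^+ 2 / N%:R) * 2)).
  apply: ler_pM => //; first by rewrite mulr_ge0 ?(ltW a0).
    by rewrite invr_ge0 normc_ge0.
  by apply: ler_pM => //; exact: ltW.
by rewrite le_eqVlt; apply/orP; left; apply/eqP; ring.
Qed.

End Roots.

End ComplexBounds.

(* The derivative of [lagp g s] is the sum of the [lagp g (rem a s)], each of
   which is related to [lagp g s] by one step. *)
Lemma sum_inv_lagp (F : fieldType) (g : F) (s zs : seq F) (ws : F -> seq F) (x : F) :
  x != 0 -> lagp g s = prod_roots zs ->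
  (forall a, a \in s -> lagp g (rem a s) = prod_roots (ws a)) ->
  (forall z, z \in zs -> x != z) ->
  (forall a z, a \in s -> z \in ws a -> x != z) ->
  sum_inv zs x = \sum_(a <- s)
    (x * (1 - a * ((g - (size s).-1%:R) / x + sum_inv (ws a) x)))^-1.
Proof.
move=> x0 zsE wsE hz hw; have Z0 := prod_roots_neq0 hz.
apply: (mulfI Z0); rewrite -deriv_prod_rootsE// -zsE deriv_lagp horner_sum mulr_sumr.
apply: eq_big_seq => a sa; have W0 := prod_roots_neq0 (hw a ^~ sa).
move: Z0; rewrite -zsE (lagp_rem g sa) wsE// lag_step_horner//; last first.
  by move=> z; exact: hw.
rewrite mulf_eq0 negb_or => /andP[W1 D0].
by rewrite mulfK.
Qed.

(** Pulling N out of each denominator leaves the weight n_j / N over u - a (al / N + 1 / N) - a u W,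
    and each piece has a limit. *)
Lemma stieltjes_limit (K : numFieldType) (F : set_system nat) r (u l A : K)
    (N : nat -> nat) (G al : nat -> K) (nn : nat -> 'I_r -> nat)
    (a W : nat -> 'I_r -> K) (a0 theta : 'I_r -> K) : ProperFilter F ->
  G @ F --> l -> (forall j, W ^~ j @ F --> l) -> (forall j, a ^~ j @ F --> a0 j) ->
  (fun m => al m / (N m)%:R) @ F --> A -> (fun m => (N m)%:R^-1 : K) @ F --> 0 ->
  (forall j, (fun m => (nn m j)%:R / (N m)%:R) @ F --> theta j) ->
  (forall j, u - a0 j * A - a0 j * u * l != 0) ->
  (\forall m \near F, (0 < N m)%N /\ G m = \sum_(j < r)
     ((N m)%:R * u *
       (1 - a m j * ((al m + 1) / ((N m)%:R * u) + W m j)))^-1 *+ nn m j) ->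
  u != 0 ->
  l = \sum_(j < r) theta j / (u - a0 j * A - a0 j * u * l).
Proof.
move=> PF Gl Wl aa0 alA N0 nth D0 GE u0; apply/esym.
have H : G @ F --> \sum_(j < r) theta j / (u - a0 j * A - a0 j * u * l); last first.
  exact: (cvg_unique _ H Gl).
have L : (fun m => \sum_(j < r) ((nn m j)%:R / (N m)%:R) /
    (u - a m j * (al m / (N m)%:R + (N m)%:R^-1) - a m j * u * W m j)) @ F -->
    \sum_(j < r) theta j / (u - a0 j * A - a0 j * u * l).
  apply: cvg_sumr => j; apply: cvgM => //; apply: cvgV => //.
  apply: cvgB; last by apply: cvgM => //; apply: cvgMl.
  apply: cvgB; first exact: cvg_cst.
  by apply: cvgM => //; rewrite -[X in _ --> X]addr0; apply: cvgD.
apply: cvg_trans L; apply: near_eq_cvg.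
apply: filterS GE => m [Nm ->]; apply: eq_bigr => j _.
have Nm0 : (N m)%:R != 0 :> K by rewrite pnatr_eq0 -lt0n.
rewrite -[RHS]mulr_natl -[LHS]mulrA -[in LHS]invfM; congr (_ * _^-1).
by field; rewrite ?Nm0 ?u0.
Qed.

(** * Limits of the Stieltjes transforms *)

Section Asymptotics.
Variables (R : realType) (r : nat) (n : nat -> 'I_r -> nat) (alpha : nat -> R).
Variables (c_ : nat -> 'I_r -> R) (A : R) (theta c : 'I_r -> R).
Hypotheses (n_gt0 : forall m i, (0 < n m i)%N)
  (n_oo : (fun m => msize (n m)) @ \oo --> \oo)
  (alpha_gtN1 : forall m, -1 < alpha m) (A_ge0 : 0 <= A)
  (alpha_cvg : (fun m => alpha m / (msize (n m))%:R) @ \oo --> A)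
  (theta_gt0 : forall i, 0 < theta i)
  (theta_cvg : forall i,
    (fun m => (n m i)%:R / (msize (n m))%:R) @ \oo --> theta i)
  (c__gt0 : forall m i, 0 < c_ m i) (c_gt0 : forall i, 0 < c i)
  (c_cvg : forall i, (fun m => c_ m i) @ \oo --> c i).

Local Notation nc := (@ComplexField.Normc.normc R).
Local Notation C := (real_complex R).
Let N m := msize (n m).
Let g m := (N m)%:R + alpha m.
Let s m := rate_seq (c_ m) (n m).

(** The case r = 0 is ruled out by |n| tending to infinity. *)
Lemma msize_gt0 m : (0 < msize (n m))%N.
Proof.
have [j _|r0] := pickP (fun _ : 'I_r => true).
  by rewrite /msize (bigD1 j)//= ltn_addr.
have N0 k : msize (n k) = 0%N.
  by rewrite /msize big1// => i _; have := r0 i.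
have [k _ hk] := n_oo (nbhs_infty_gt 0).
by have := hk k (leqnn k); rewrite /= N0.
Qed.

Let N0 m : 0 < (N m)%:R :> R. Proof. by rewrite ltr0n msize_gt0. Qed.

Lemma gamma_gt0 m : 0 < g m.
Proof.
have : 1 <= (N m)%:R :> R by rewrite ler1n msize_gt0.
by have := alpha_gtN1 m; rewrite /g; lra.
Qed.

Lemma rate_seq_gt0 m : all (> 0) (s m).
Proof.
apply/allP => a /flatten_mapP[j _]; rewrite mem_nseq => /andP[_ /eqP ->] /=.
by rewrite invr_gt0.
Qed.

Lemma lagp_splits (g0 : R) s0 : 0 < g0 -> (size s0)%:R - 1 < g0 ->
  all (> 0) s0 -> exists zs, lagp g0 s0 = prod_roots zs.
Proof.
move=> g00 sg s00; pose b := 1 + \sum_(a <- s0) a.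
have S0 : 0 <= \sum_(a <- s0) a.
  by rewrite big_seq; apply: sumr_ge0 => a /(allP s00) /ltW.
have b0 : 0 < b by rewrite /b; lra.
have [|zs [_ _ zsE _]] := lagp_barrier g00 b0 sg (s := s0); last by exists zs.
apply/allP => a as0; rewrite (allP s00 _ as0) /= /b.
rewrite (perm_big _ (perm_to_rem as0)) /= big_cons.
have : 0 <= \sum_(a <- rem a s0) a.
  by rewrite big_seq; apply: sumr_ge0 => x /mem_rem/(allP s00) /ltW.
lra.
Qed.

Lemma lagp_roots_bound (g0 am : R) s0 zs : 0 < g0 -> 0 < am ->
  (size s0)%:R - 1 < g0 -> all (fun a => 0 < a <= am) s0 ->
  lagp g0 s0 = prod_roots zs ->
  all (fun z => 0 < z < 2 * am * (g0 + (size s0)%:R)) zs.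
Proof.
move=> g00 am0 sg s0am zsE.
have [ys [ys0 ysB ysE _]] := lagp_barrier g00 am0 sg s0am.
apply/allP => z zzs.
have zys : z \in ys by rewrite -root_prod_XsubC -/(prod_roots ys) -ysE zsE root_prod_XsubC.
by apply/andP; split; [exact: (allP ys0 _ zys) | exact: (allP ysB _ zys)].
Qed.

Lemma size_s m : size (s m) = N m.
Proof. exact: size_rate_seq. Qed.

Lemma s_gamma m : (size (s m))%:R - 1 < g m.
Proof. by rewrite size_s /g; have := alpha_gtN1 m; lra. Qed.

Lemma zeros_exist : exists zs : nat -> seq R,
  forall m, lagp (g m) (s m) = prod_roots (zs m).
Proof.
have h m := lagp_splits (gamma_gt0 m) (s_gamma m) (rate_seq_gt0 m).
by have [zs zsE] := choice h; exists zs.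
Qed.

Lemma rem_zeros_exist : exists ws : nat -> R -> seq R,
  forall m a, a \in s m -> lagp (g m) (rem a (s m)) = prod_roots (ws m a).
Proof.
have h m a : exists w, a \in s m -> lagp (g m) (rem a (s m)) = prod_roots w.
  have [sa|//] := boolP (a \in s m); last by exists [::].
  have [||w wE] := @lagp_splits (g m) (rem a (s m)) (gamma_gt0 m).
  - by rewrite size_rem// (le_lt_trans _ (s_gamma m))// lerD2r ler_nat leq_pred.
  - by apply/allP => x /mem_rem; exact/allP/rate_seq_gt0.
  by exists w.
by exists (fun m => projT1 (choice (h m))) => m; exact: projT2 (choice (h m)).
Qed.

(** Strictly above each limit rate 1 / c_j, hence eventually above the actual rates. *)
Definition rate_bound := 1 + \sum_(j < r) (c j)^-1.
Let am := rate_bound.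
(** Eventually alpha <= (A + 1) N, and 1 <= N, so b = alpha + 1 is at most K N. *)
Let K := A + 2.
(** The barrier 2 am (g + N) is eventually at most 2 am (A + 3) N; the slightly larger K + 2 is the
    constant that [step_denominator] needs. *)
Definition zero_bound := 2 * am * (K + 2).
Let M0 := zero_bound.

Lemma rate_bound_gt j : (c j)^-1 < am.
Proof.
rewrite /am /rate_bound (bigD1 j)//=.
have : 0 <= \sum_(i < r | i != j) (c i)^-1.
  by apply: sumr_ge0 => i _; rewrite invr_ge0 ltW.
lra.
Qed.

Lemma rate_bound_gt0 : 0 < am.
Proof.
have : 0 <= \sum_(i < r) (c i)^-1.
  by apply: sumr_ge0 => i _; rewrite invr_ge0 ltW.
rewrite /am /rate_bound; lra.
Qed.

Lemma zero_bound_gt0 : 0 < M0.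
Proof. have K2 : 0 < K + 2 by rewrite /K; move: A_ge0; lra.
by rewrite /M0 /zero_bound mulr_gt0// mulr_gt0// rate_bound_gt0. Qed.

Lemma rate_cvg j : (fun m => (c_ m j)^-1) @ \oo --> (c j)^-1.
Proof. by apply: cvgV => //; rewrite gt_eqF. Qed.

Lemma near_rate_bound : \forall m \near \oo, forall j, (c_ m j)^-1 <= am.
Proof.
apply: filter_forall => j; have := rate_cvg (j := j).
move/cvgrPdist_lt/(_ (am - (c j)^-1)); rewrite subr_gt0 rate_bound_gt => /(_ isT).
apply: filterS => m; rewrite distrC ltr_norml => /andP[_]; lra.
Qed.

Lemma near_alpha_bound : \forall m \near \oo, alpha m <= (A + 1) * (N m)%:R.
Proof.
move/cvgrPdist_lt/(_ 1 ltr01) : alpha_cvg; apply: filterS => m.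
rewrite distrC ltr_norml => /andP[_ h].
by rewrite -ler_pdivrMr//; lra.
Qed.

Let good m := (forall j, (c_ m j)^-1 <= am) /\ alpha m <= (A + 1) * (N m)%:R.

Lemma near_good : \forall m \near \oo, good m.
Proof. by apply: filterI; [exact: near_rate_bound | exact: near_alpha_bound]. Qed.

Lemma good_s m : good m -> all (fun a => 0 < a <= am) (s m).
Proof.
move=> [h _]; apply/allP => a sa; rewrite (allP (rate_seq_gt0 m) _ sa) /=.
by move: sa => /flatten_mapP[j _]; rewrite mem_nseq => /andP[_ /eqP ->].
Qed.

Lemma good_bound m k : good m -> (k <= N m)%N ->
  2 * am * (g m + k%:R) <= (N m)%:R * M0.
Proof.
move=> [_ h] kN; rewrite /M0 /zero_bound mulrCA ler_pM2l; last first.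
  by rewrite mulr_gt0 ?rate_bound_gt0.
have : k%:R <= (N m)%:R :> R by rewrite ler_nat.
by have := N0 m; rewrite /g /K; lra.
Qed.

Lemma good_zeros m zs : good m -> lagp (g m) (s m) = prod_roots zs ->
  all (fun z => 0 < z < (N m)%:R * M0) zs.
Proof.
move=> gm zsE; have := lagp_roots_bound (gamma_gt0 m) rate_bound_gt0 (s_gamma m) (good_s gm) zsE.
apply: sub_all => z /andP[-> h] /=; apply: (lt_le_trans h).
by apply: good_bound => //; rewrite size_s.
Qed.

Lemma good_rem_zeros m a zs : good m -> a \in s m ->
  lagp (g m) (rem a (s m)) = prod_roots zs ->
  all (fun z => 0 < z < (N m)%:R * M0) zs.
Proof.
move=> gm sa zsE.
have h1 : (size (rem a (s m)))%:R - 1 < g m.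
  by rewrite size_rem// (le_lt_trans _ (s_gamma m))// lerD2r ler_nat leq_pred.
have h2 : all (fun a => 0 < a <= am) (rem a (s m)).
  by apply/allP => x /mem_rem; exact: (allP (good_s gm)).
have := lagp_roots_bound (gamma_gt0 m) rate_bound_gt0 h1 h2 zsE.
apply: sub_all => z /andP[-> h] /=; apply: (lt_le_trans h).
by apply: good_bound => //; rewrite size_rem// size_s leq_pred.
Qed.

Lemma mem_rate_seq m j : (c_ m j)^-1 \in s m.
Proof.
apply/flatten_mapP; exists j; first by rewrite mem_enum.
by rewrite mem_nseq n_gt0 eqxx.
Qed.

Lemma size_lagp_roots (g0 : R) s0 zs : lagp g0 s0 = prod_roots zs -> size zs = size s0.
Proof.
move=> zsE; have [_] := lagp_monic g0 s0.
by rewrite zsE size_prod_roots => -[].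
Qed.

Variables (zs : nat -> seq R) (ws : nat -> R -> seq R).
Hypothesis zsE : forall m, lagp (g m) (s m) = prod_roots (zs m).
Hypothesis wsE : forall m a, a \in s m ->
  lagp (g m) (rem a (s m)) = prod_roots (ws m a).

(** * The limit equation at a fixed point u *)

Section FixedPoint.
Variable u : R[i].
Hypothesis u_gt : 2 * M0 < nc u.

Let u_gt0 : 0 < nc u.
Proof. by rewrite (lt_trans _ u_gt)// mulr_gt0// zero_bound_gt0. Qed.

Let u_neq0 : u != 0. Proof. exact: normc_gt0_neq0. Qed.

Let u_am : 2 * am * (K + 2) <= nc u.
Proof. by move: u_gt zero_bound_gt0; rewrite -/M0 -/zero_bound -/M0; lra. Qed.

Let G m := sum_inv (map C (zs m)) ((N m)%:R * u).
Let W m j := sum_inv (map C (ws m (c_ m j)^-1)) ((N m)%:R * u).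

Lemma normc_G m : good m -> nc (u * G m) <= 2.
Proof.
move=> gm; rewrite ComplexField.Normc.normcM.
have := normc_sum_inv (msize_gt0 m) u_gt0 (ltW u_gt) (good_zeros gm (zsE m)).
rewrite (size_lagp_roots (zsE m)) size_s -/(N m) -/(G m) => h.
rewrite -ler_pdivlMl//; apply: (le_trans h).
by rewrite le_eqVlt; apply/orP; left; apply/eqP; field; rewrite !gt_eqF.
Qed.

Lemma good_alpha m : good m -> 0 <= alpha m + 1 <= K * (N m)%:R.
Proof.
move=> [_ h]; have := alpha_gtN1 m => h1.
have h2 : 1 <= (N m)%:R :> R by rewrite ler1n msize_gt0.
by rewrite /K; apply/andP; split; lra.
Qed.

Lemma gamma_pred m : g m - (size (s m)).-1%:R = alpha m + 1.
Proof.
rewrite size_s /g -subn1 natrB ?msize_gt0//; ring.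
Qed.

Lemma good_exact m : good m -> G m = \sum_(j < r)
  ((N m)%:R * u * (1 - ((c_ m j)^-1)%:C *
     (((alpha m)%:C + 1) / ((N m)%:R * u) + W m j)))^-1 *+ n m j.
Proof.
move=> gm; have gz := good_zeros gm (zsE m).
have Nu : (N m)%:R * u != 0 by rewrite normc_gt0_neq0// normc_natM mulr_gt0.
(* The rates have been mapped into R[i], while [ws] is indexed by real ones. *)
pose ws' (a : R[i]) := map C (ws m (complex.Re a)).
have e1 : lagp (g m)%:C (map C (s m)) = prod_roots (map C (zs m)).
  by rewrite -map_lagp zsE map_prod_roots.
rewrite /G (sum_inv_lagp Nu e1 (ws := ws')); first last.
- move=> _ z /mapP[a sa ->] /=; rewrite /ws' /=.
  by apply: (root_neq (msize_gt0 m) u_gt0 (ltW u_gt)); exact: good_rem_zeros gm sa (wsE sa).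
- by move=> z; apply: (root_neq (msize_gt0 m) u_gt0 (ltW u_gt)).
- move=> _ /mapP[a sa ->] /=; rewrite /ws' /= -map_prod_roots -wsE// map_lagp.
  by rewrite rem_map//; exact: complexI.
have e2 : (g m)%:C - (size (map C (s m))).-1%:R = (alpha m)%:C + 1 :> R[i].
  rewrite size_map -(rmorph_nat C (size (s m)).-1) -rmorphB gamma_pred.
  by rewrite rmorphD rmorph1.
by rewrite big_map e2 big_rate_seq.
Qed.

Lemma good_close m j : good m ->
  nc (G m - W m j) <= ((nc u)^-1 + 2 * am * (K + 4) / nc u ^+ 2) / (N m)%:R.
Proof.
move=> gm; have sa := mem_rate_seq m j.
have gz := good_zeros gm (zsE m); have gw := good_rem_zeros gm sa (wsE sa).
have ha := allP (good_s gm) _ sa.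
have h1 : (size (ws m (c_ m j)^-1) <= N m)%N.
  by rewrite (size_lagp_roots (wsE sa)) size_rem// size_s leq_pred.
have h2 : prod_roots (zs m) = lag_step (alpha m + 1) (c_ m j)^-1 (prod_roots (ws m (c_ m j)^-1)).
  by rewrite -zsE -wsE// (lagp_rem (g m) sa) gamma_pred.
exact: (log_deriv_close (msize_gt0 m) u_gt0 (ltW u_gt) u_am ha (good_alpha gm) gz gw h1 h2).
Qed.

Let KC : numFieldType := R[i].

Lemma normc_cvg (F : set_system nat) (f : nat -> KC) (l : KC) : Filter F ->
  (fun m => nc (f m - l)) @ F --> (0 : R) -> f @ F --> l.
Proof.
move=> FF /cvgrPdist_lt fl; apply/cvgrPdist_lt => e e0.
have eE : e = (complex.Re e)%:C by rewrite RRe_real ?gtr0_real.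
have e1 : 0 < complex.Re e by rewrite eE ltcR in e0.
apply: filterS (fl _ e1) => m.
by rewrite sub0r normrN ger0_norm ?normc_ge0// distrC normc_norm eE ltcR.
Qed.

Lemma real_cvg (F : set_system nat) (x : nat -> R) (y : R) : Filter F ->
  x @ F --> y -> (fun m => (x m)%:C : KC) @ F --> (y%:C : KC).
Proof.
move=> FF xy; apply: normc_cvg.
have -> : (fun m => nc ((x m)%:C - y%:C)) = (fun m => `|x m - y|).
  by apply/funext => m; rewrite -rmorphB normc_real.
rewrite -[X in _ --> X](@normr0 R R) -(subrr y).
by apply: cvg_norm; apply: cvgB => //; exact: cvg_cst.
Qed.

Lemma inv_msize_cvg : (fun m => (N m)%:R^-1 : R) @ \oo --> 0.
Proof.
apply/cvgrPdist_lt => e e0.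
have h : \forall m \near \oo, e^-1 < (N m)%:R by exact: (n_oo (nbhs_infty_gtr e^-1)).
apply: filterS h => m h.
rewrite sub0r normrN gtr0_norm ?invr_gt0// invf_plt ?posrE//.
Qed.

(** Multiplied by c_j this is c_j u - (y + A) with y = u l, the denominator of the claimed
    equation. *)
Definition limit_denominator j (l : R[i]) :=
  u - (c j)^-1%:C * A%:C - (c j)^-1%:C * u * l.

Lemma limit_denominator_ge j l : nc (u * l) <= 2 ->
  nc u / 2 <= nc (limit_denominator j l).
Proof.
move=> ul; have cj : 0 < (c j)^-1 by rewrite invr_gt0.
have cam := ltW (rate_bound_gt j).
have -> : limit_denominator j l = u - (c j)^-1%:C * (A%:C + u * l).
  by rewrite /limit_denominator; ring.
apply: le_trans (normcB_ge _ _).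
rewrite ComplexField.Normc.normcM normc_real gtr0_norm//.
have h : nc (A%:C + u * l) <= A + 2.
  by apply: (le_trans (le_normcD _ _)); rewrite normc_real ger0_norm// lerD2l.
have h2 : (c j)^-1 * nc (A%:C + u * l) <= am * (A + 2).
  by apply: ler_pM => //; [exact: ltW | exact: normc_ge0].
have h3 : am * (A + 2) * 2 <= nc u.
  apply: le_trans u_am; rewrite /K; have := rate_bound_gt0.
  rewrite -/am; move: (am) => q; lra.
lra.
Qed.

Lemma limit_denominator_neq0 j l : nc (u * l) <= 2 -> limit_denominator j l != 0.
Proof.
move=> /(limit_denominator_ge j) h; apply: normc_gt0_neq0.
by apply: lt_le_trans h; rewrite divr_gt0.
Qed.

Lemma sum_theta : \sum_(j < r) theta j = 1.
Proof.
have L : (fun m => \sum_(j < r) (n m j)%:R / (N m)%:R : R) @ \oo --> \sum_(j < r) theta j.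
  by apply: cvg_sumr => j; exact: theta_cvg.
have E : (fun m => \sum_(j < r) (n m j)%:R / (N m)%:R : R) = cst 1.
  apply/funext => m; by rewrite -mulr_suml -natr_sum -/(msize (n m)) mulfV// (lt0r_neq0 (N0 m)).
have L1 : (cst 1 : nat -> R) @ \oo --> (1 : R) by exact: cvg_cst.
by rewrite E in L; exact: (cvg_unique _ L L1).
Qed.

(** The filter is left general for two uses: ultrafilters when convergence is still to be proved,
    and [\oo] itself once the limit is known to be the Cauchy transform. The bound on u l keeps the
    denominators away from 0 and selects the small solution. *)
Lemma limit_equation (F : set_system nat) (l : R[i]) : ProperFilter F ->
  \oo `<=` F -> (fun m => nc (G m - l)) @ F --> (0 : R) ->
  nc (u * l) <= 2 /\ l = \sum_(j < r) (theta j)%:C / limit_denominator j l.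
Proof.
move=> PF ooF Gl.
have ul : nc (u * l) <= 2.
  apply/ler_addgt0Pr => e e0.
  have /cvgrPdist_lt/(_ (e / nc u)) := Gl; rewrite divr_gt0// => /(_ isT) h.
  have [m [gm hm]] := filter_ex (filterI (ooF _ near_good) h).
  rewrite sub0r normrN ger0_norm ?normc_ge0// ltr_pdivlMr// in hm.
  have -> : u * l = u * G m - u * (G m - l) by ring.
  apply: (le_trans (le_normcB _ _)); have := normc_G gm.
  rewrite [X in _ + X]ComplexField.Normc.normcM; lra.
split => //.
have toF (T : topologicalType) (f : nat -> T) (y : T) : f @ \oo --> y -> f @ F --> y.
  by move=> fy; apply: cvg_trans fy; exact: cvg_app.
have GK : (G : nat -> KC) @ F --> (l : KC) by exact: normc_cvg.
have WK j : (W ^~ j : nat -> KC) @ F --> (l : KC).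
  apply: normc_cvg; pose Cu := (nc u)^-1 + 2 * am * (K + 4) / nc u ^+ 2.
  apply: (@squeeze_cvgr _ _ _ _ (cst 0) (fun m => Cu / (N m)%:R + nc (G m - l))).
  - apply: filterS (ooF _ near_good) => m gm; rewrite normc_ge0 /=.
    have -> : W m j - l = (G m - l) - (G m - W m j) by ring.
    by apply: (le_trans (le_normcB _ _)); rewrite addrC lerD2r; exact: good_close.
  - exact: cvg_cst.
  rewrite -[X in _ --> X](addr0 (0 : R)); apply: cvgD => //.
  by rewrite -[X in _ --> X](mulr0 Cu); apply: cvgMr; apply: toF; exact: inv_msize_cvg.
have NK m : (N m)%:R = ((N m)%:R)%:C :> R[i] by rewrite rmorph_nat.
have := @stieltjes_limit KC F r u l A%:C N G (fun m => (alpha m)%:C) n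
  (fun m j => (c_ m j)^-1%:C) W (fun j => (c j)^-1%:C) (fun j => (theta j)%:C) PF GK WK.
move=> H; apply: H.
- by move=> j; apply: real_cvg; apply: toF; exact: rate_cvg.
- under eq_fun do rewrite NK -rmorphV ?unitfE ?gt_eqF// -rmorphM.
  by apply: real_cvg; exact: toF.
- under eq_fun do rewrite NK -rmorphV ?unitfE ?gt_eqF//.
  by apply: (@real_cvg _ _ 0); apply: toF; exact: inv_msize_cvg.
- move=> j; under eq_fun do rewrite NK -(rmorph_nat C) -rmorphV ?unitfE ?gt_eqF// -rmorphM.
  by apply: real_cvg; exact: toF.
- by move=> j; exact: limit_denominator_neq0.
- apply: filterS (ooF _ near_good) => m gm; split; first exact: msize_gt0.
  exact: good_exact.
- exact: u_neq0.
Qed.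

(* The right-hand side of the limit equation contracts by a factor 1/4. *)
Lemma limit_unique (l l' : R[i]) : nc (u * l) <= 2 -> nc (u * l') <= 2 ->
  l = \sum_(j < r) (theta j)%:C / limit_denominator j l ->
  l' = \sum_(j < r) (theta j)%:C / limit_denominator j l' -> l = l'.
Proof.
move=> ul ul' lE lE'; apply/eqP; rewrite -subr_eq0; apply/eqP.
apply: (@ComplexField.Normc.eq0_normc R); apply/eqP.
set d := nc (l - l'); have d0 : 0 <= d by exact: normc_ge0.
have am0 := rate_bound_gt0; rewrite -/am in am0.
(* Here 2 M0 = 4 am (A + 4). With both denominators at least |u| / 2, the Lipschitz constant is at
   most 4 am / |u|, hence at most 1/4. *)
have uam : 16 * am <= nc u.
  apply: le_trans (ltW u_gt); rewrite /M0 /zero_bound -/am /K.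
  by have := mulr_ge0 (ltW am0) A_ge0; move: (am) => q; lra.
suff : d <= 4^-1 * d by rewrite eq_le d0 andbT; lra.
rewrite {1}/d {1}lE {1}lE' -sumrB; apply: (le_trans (le_normc_sum _ _)).
apply: (@le_trans _ _ (\sum_(j < r) theta j * (4^-1 * d))); last first.
  by rewrite -mulr_suml sum_theta mul1r.
apply: ler_sum => j _; have cj : 0 < (c j)^-1 by rewrite invr_gt0.
have cam := ltW (rate_bound_gt j); rewrite -/am in cam.
have D1 := limit_denominator_ge j ul; have D2 := limit_denominator_ge j ul'.
have D10 := limit_denominator_neq0 j ul; have D20 := limit_denominator_neq0 j ul'.
have -> : (theta j)%:C / limit_denominator j l - (theta j)%:C / limit_denominator j l' =
    (theta j)%:C * ((c j)^-1%:C * u * (l - l') / (limit_denominator j l * limit_denominator j l')).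
  have -> : (c j)^-1%:C * u * (l - l') = limit_denominator j l' - limit_denominator j l.
    by rewrite /limit_denominator; ring.
  by field; rewrite D10 D20.
rewrite !ComplexField.Normc.normcM ComplexField.Normc.normcV ComplexField.Normc.normcM.
rewrite !normc_real !gtr0_norm// ler_pM2l// -/d mulrAC ler_wpM2r//.
set p := nc (limit_denominator j l) in D1 *.
set q := nc (limit_denominator j l') in D2 *.
have u2 : 0 < nc u / 2 by rewrite divr_gt0.
have pq : (nc u / 2) * (nc u / 2) <= p * q by apply: ler_pM => //; exact: ltW.
rewrite ler_pdivrMr; last by apply: lt_le_trans pq; rewrite mulr_gt0.
apply: (@le_trans _ _ (4^-1 * ((nc u / 2) * (nc u / 2)))); last by rewrite ler_pM2l.
have := ler_wpM2r (ltW u_gt0) uam; have := ler_wpM2r (ltW u_gt0) cam.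
move: ((c j)^-1) (nc u) (am) => x y w; nra.
Qed.

End FixedPoint.

Let vs m := map (fun z => z / (N m)%:R) (zs m).

Lemma size_vs m : size (vs m) = N m.
Proof. by rewrite size_map (size_lagp_roots (zsE m)) size_s. Qed.

Lemma vs_oo : (fun m => size (vs m)) @ \oo --> \oo.
Proof. by under eq_fun do rewrite size_vs. Qed.

Lemma vs_bound : \forall m \near \oo, all (fun v => 0 <= v <= M0) (vs m).
Proof.
apply: filterS near_good => m gm; rewrite all_map.
apply: sub_all (good_zeros gm (zsE m)) => z /andP[z0 zM] /=.
apply/andP; split; first by rewrite divr_ge0// ltW.
by rewrite ler_pdivrMr// mulrC ltW.
Qed.

Lemma avg_stieltjes m x :
  avg (vs m) (fun v => (x - v)^-1) = sum_inv (zs m) ((N m)%:R * x).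
Proof.
rewrite /avg size_vs big_map /sum_inv mulr_sumr; apply: eq_bigr => z _.
rewrite -invfM; congr _^-1; field; exact: lt0r_neq0.
Qed.

(** A filter is the intersection of the ultrafilters containing it. *)
Lemma ultra_cvg (x : nat -> R) (l : R) :
  (forall U, UltraFilter U -> \oo `<=` U -> x @ U --> l) -> x @ \oo --> l.
Proof.
move=> h V Vl; apply: contrapT => nV.
pose F := within (~` (x @^-1` V)) \oo.
have PF : ProperFilter F.
  apply: Build_ProperFilter_ex => B FB; apply: contrapT => nB; apply: nV.
  apply: (@filterS _ \oo _ [set m | (~` (x @^-1` V)) m -> B m] (x @^-1` V) _ FB).
  move=> m Bm; apply: contrapT => nVm.
  by apply: nB; exists m; apply: Bm.
have [U [UU FU]] := ultraFilterLemma PF.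
have ooU : \oo `<=` U by move=> B oB; apply: FU; apply: filterS oB.
have UnV : U (~` (x @^-1` V)) by apply: FU; apply: nearW.
have UV : U (x @^-1` V) by exact: (h U UU ooU).
by have [m []] := filter_ex (filterI UV UnV).
Qed.

(** Real points suffice for the moments, and compactness is then needed in R only. Limits along two
    ultrafilters solve the same equation under the same bound, so they agree by [limit_unique]. *)
Lemma stieltjes_cvg x : 2 * M0 < x ->
  cvg (avg (vs m) (fun v => (x - v)^-1) @[m --> \oo]).
Proof.
move=> xM; have M00 := zero_bound_gt0.
have x0 : 0 < x by rewrite (lt_trans _ xM)// mulr_gt0.
have ux : 2 * M0 < nc x%:C by rewrite normc_real gtr0_norm.
pose y m := sum_inv (zs m) ((N m)%:R * x).
have yE m : sum_inv (map C (zs m)) ((N m)%:R * x%:C) = (y m)%:C.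
  by rewrite -(rmorph_nat C) -rmorphM sum_inv_map.
have lim U : UltraFilter U -> \oo `<=` U -> exists l : R, y @ U --> l.
  move=> UU ooU; apply: (@ultra_bounded_cvg _ _ _ (- (2 / x)) (2 / x)).
  apply: filterS (ooU _ near_good) => m gm.
  have := normc_G ux gm; rewrite yE -rmorphM normc_real normrM gtr0_norm//.
  by rewrite mulrC -ler_pdivlMr// ler_norml.
have lim_eq U (l : R) : UltraFilter U -> \oo `<=` U -> y @ U --> l ->
    nc (x%:C * l%:C) <= 2 /\
    l%:C = \sum_(j < r) (theta j)%:C / limit_denominator x%:C j l%:C.
  move=> UU ooU yl; apply: (limit_equation ux (F := U)) => //.
  have -> : (fun m => nc (sum_inv (map C (zs m)) ((N m)%:R * x%:C) - l%:C)) =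
      (fun m => `|y m - l|) by apply/funext => m; rewrite yE -rmorphB normc_real.
  rewrite -[X in _ --> X](@normr0 R R) -(subrr l).
  by apply: cvg_norm; apply: cvgB => //; exact: cvg_cst.
have [U0 [UU0 ooU0]] := ultraFilterLemma (_ : ProperFilter \oo).
have [l0 yl0] := lim U0 UU0 ooU0; have [b0 e0] := lim_eq _ _ UU0 ooU0 yl0.
under eq_fun do rewrite avg_stieltjes.
apply/cvg_ex; exists l0; apply: ultra_cvg => U UU ooU.
have [l yl] := lim U UU ooU; have [b e] := lim_eq _ _ UU ooU yl.
by have /complexI -> := limit_unique ux b0 b e0 e.
Qed.

Theorem weak_limit : exists nu : probability (R * R)%type R,
  forall f : R * R -> R, continuous f -> (exists B : R, forall z, `|f z| <= B) ->
    avg (vs m) (fun v => f (v, 0)) @[m --> \oo] --> (\int[nu]_z f z)%R.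
Proof.
apply: (moment_weak_limit zero_bound_gt0 vs_oo vs_bound) => k.
exact: (moment_cvg zero_bound_gt0 vs_bound stieltjes_cvg).
Qed.

End Asymptotics.

(** * The Cauchy transform of a limiting distribution *)

Lemma prod_roots_rescale (F : fieldType) (zs : seq F) (k : F) : k != 0 ->
  prod_roots zs \Po (k *: 'X) =
  k ^+ size zs *: prod_roots (map (fun z => z / k) zs).
Proof.
move=> k0; rewrite /prod_roots; elim: zs => [|z zs IH].
  by rewrite !big_nil expr0 scale1r rmorph1.
rewrite /= !big_cons rmorphM /= IH comp_polyB comp_polyX comp_polyC exprS -scalerA.
have -> : k *: 'X - z%:P = k *: ('X - (z / k)%:P).
  by rewrite scalerBr -[X in _ = _ - X]mul_polyC -polyCM [k * _]mulrC divfK.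
by rewrite -scalerAl -scalerAr.
Qed.

(** The list [complex_zeros] comes from an existence statement, so its order is unknown. *)
Lemma complex_zeros_perm (R : realType) (k : R) (zs : seq R) : k != 0 ->
  perm_eq (complex_zeros (k *: prod_roots zs)) (map (real_complex R) zs).
Proof.
move=> k0; rewrite /complex_zeros.
case: closed_field_poly_normal => rs /=.
rewrite map_polyZ lead_coefZ map_prod_roots.
have -> : lead_coef (prod_roots (map (real_complex R) zs)) = 1.
  by apply/monicP; exact: monic_prod_XsubC.
rewrite mulr1 => /(scalerI _) h.
by rewrite perm_sym; apply: prod_XsubC_eq; apply: h; rewrite fmorph_eq0.
Qed.

Lemma Rintegral_zero_counting (R : realType) (k : R) (zs : seq R) (f : R * R -> R) :
  k != 0 -> continuous f ->
  (\int[zero_counting (k *: prod_roots zs)]_z f z)%R = avg zs (fun v => f (v, 0)).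
Proof.
move=> k0 cf; rewrite Rintegral_mscale_msum_dirac; last exact: continuous_plane_measurable.
have P := complex_zeros_perm zs k0.
rewrite /= (perm_size P) size_map /avg; congr (_ * _).
rewrite -(big_mkord xpredT (fun i => f (plane_of_complex (complex_zeros (k *: prod_roots zs))`_i))).
have -> : size zs = size (complex_zeros (k *: prod_roots zs)) by rewrite (perm_size P) size_map.
rewrite -(big_nth 0 xpredT (fun z => f (plane_of_complex z))).
by rewrite (perm_big _ P) big_map.
Qed.

Lemma continuous_maxr (R : realType) (T : topologicalType) (f g : T -> R) :
  continuous f -> continuous g -> continuous (fun x => Num.max (f x) (g x)).
Proof. by move=> cf cg x; exact: (@continuous_max R T f g x (cf x) (cg x)). Qed.

Lemma continuous_minr (R : realType) (T : topologicalType) (f g : T -> R) :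
  continuous f -> continuous g -> continuous (fun x => Num.min (f x) (g x)).
Proof. by move=> cf cg x; exact: (@continuous_min R T f g x (cf x) (cg x)). Qed.

(** * Support of a limiting distribution *)

Section SegmentSupport.
Variables (R : realType) (mu : probability (R * R)%type R).
Variables (vs : nat -> seq R) (M : R).
Hypotheses (M_gt0 : 0 < M)
  (vs_in : \forall m \near \oo, all (fun v => 0 <= v <= M) (vs m))
  (vs_mu : forall f : R * R -> R, continuous f ->
     (exists B : R, forall z, `|f z| <= B) ->
     avg (vs m) (fun v => f (v, 0)) @[m --> \oo] --> (\int[mu]_z f z)%R).
Implicit Types (h : R * R -> R).

(** A continuous retraction of the plane onto the segment; composed with it, a kernel whose pole is
    off the segment becomes an admissible test function. *)
Definition segment_retract (v : R * R) : R * R := (Num.max 0 (Num.min M v.1), 0).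
Let ret := segment_retract.

Lemma segment_retract_bound v : 0 <= (ret v).1 <= M.
Proof. by rewrite /ret /= le_max lexx /= ge_max (ltW M_gt0) ge_min lexx. Qed.

Lemma segment_retract_id x : 0 <= x <= M -> ret (x, 0) = (x, 0).
Proof. by case/andP=> x0 xM; rewrite /ret /segment_retract /= min_r// max_r. Qed.

Lemma continuous_retract_fst : continuous (fun v => (ret v).1).
Proof.
apply: continuous_maxr; first by move=> v; exact: cvg_cst.
by apply: continuous_minr => v; [exact: cvg_cst | exact: cvg_fst].
Qed.

(** The test function [phi] is nonnegative, bounded, continuous and zero exactly on the segment; its
    averages are eventually 0, hence so is its integral. *)
Lemma segment_ae : {ae mu, forall v, ret v = v}.
Proof.
pose phi (v : R * R) := Num.min 1 (`|v.1 - (ret v).1| + `|v.2|).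
have phi0 (v : R * R) : 0 <= phi v by rewrite /phi le_min ler01 addr_ge0.
have cphi : continuous phi.
  apply: continuous_minr => v; first exact: cvg_cst.
  apply: cvgD; apply: cvg_norm; last exact: cvg_snd.
  by apply: cvgB; [exact: cvg_fst | exact: continuous_retract_fst].
have bphi : forall v, `|phi v| <= 1 by move=> v; rewrite ger0_norm// /phi ge_min lexx.
have mphi := continuous_plane_measurable cphi.
have iphi : mu.-integrable setT (EFin \o phi).
  apply: measurable_bounded_integrable => //; first exact: le_lt_trans (probability_le1 _ _) (ltry _).
  by exists 1; split => // x x1 v _ /=; apply: le_trans (bphi v) (ltW x1).
have int0 : (\int[mu]_v phi v)%R = 0.
  have L := vs_mu cphi (ex_intro _ 1 bphi).
  suff Z : avg (vs m) (fun x => phi (x, 0)) @[m --> \oo] --> (0 : R).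
    exact: (cvg_unique _ L Z).
  apply: cvg_near_cst; apply: filterS vs_in => m /allP vsm.
  rewrite /avg big_seq big1 ?mulr0// => v /vsm vM.
  by rewrite /phi segment_retract_id//= subrr normr0 addr0 min_r.
have : (\int[mu]_v `|(EFin \o phi) v|)%E = 0%E.
  under eq_integral do rewrite /= ger0_norm//.
  by rewrite -[RHS]/(0%:E) -int0 /Rintegral fineK//; exact: integrable_fin_num.
move/ae_eq_integral_abs => /(_ measurableT) H.
have /H := (proj2 (measurable_EFinP _ _) mphi).
apply: filterS => v /(_ I) /= [] /eqP.
rewrite /phi /Num.min; case: ifP => [_|_]; first by rewrite oner_eq0.
rewrite paddr_eq0// !normr_eq0 subr_eq0 => /andP[/eqP v1 /eqP v2].
by apply/esym; rewrite [LHS]surjective_pairing v2 {1}v1.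
Qed.

(** The function h may be singular off the segment, as the Cauchy kernel is; it agrees with
    [h \o ret] almost everywhere and at the points of [vs m] for large m. *)
Lemma segment_transfer h (B : R) : measurable_fun setT h ->
  continuous (h \o ret) -> (forall v, `|h (ret v)| <= B) ->
  mu.-integrable setT (EFin \o h) /\
  avg (vs m) (fun x => h (x, 0)) @[m --> \oo] --> (\int[mu]_z h z)%R.
Proof.
move=> mh ch hB; have mhr := continuous_plane_measurable ch.
have ihr : mu.-integrable setT (EFin \o (h \o ret)).
  apply: measurable_bounded_integrable => //; first exact: le_lt_trans (probability_le1 _ _) (ltry _).
  exists B; split => [|x x1 v _ /=]; first exact: num_real.
  exact: le_trans (hB v) (ltW x1).
have ae : ae_eq mu setT (EFin \o (h \o ret)) (EFin \o h).
  by apply: filterS segment_ae => v rv _ /=; rewrite rv.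
have mE : measurable_fun setT (EFin \o h) by exact/measurable_EFinP.
have mEr : measurable_fun setT (EFin \o (h \o ret)) by exact/measurable_EFinP.
split.
  apply/integrableP; split => //.
  move/integrableP: ihr => [_]; congr (_ < _)%E.
  apply: ae_eq_integral => //; try exact: measurableT_comp.
  by apply: filterS ae => v /(_ I) /= [->].
have -> : (\int[mu]_z h z)%R = (\int[mu]_z (h \o ret) z)%R.
  by rewrite /Rintegral; congr fine; apply: ae_eq_integral => //; exact: ae_eq_sym.
apply: (cvg_trans _ (vs_mu ch (ex_intro _ B hB))); apply: near_eq_cvg.
apply: filterS vs_in => m /allP vsm; apply: eq_avg => v /vsm vM /=.
by rewrite segment_retract_id.
Qed.

End SegmentSupport.

Section CauchyTransform.
Variables (R : realType) (u : R[i]).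
Local Notation nc := (@ComplexField.Normc.normc R).

Let den (v : R * R) := (complex.Re u - v.1) ^+ 2 + (complex.Im u - v.2) ^+ 2.

Lemma cauchy_kernel_Re v :
  complex.Re (cauchy_kernel u v) = (complex.Re u - v.1) / den v.
Proof. by case: u @den => p q; case: v. Qed.

Lemma cauchy_kernel_Im v :
  complex.Im (cauchy_kernel u v) = (v.2 - complex.Im u) / den v.
Proof. by rewrite -[v.2 - _]opprB mulNr; case: u @den => p q; case: v. Qed.

Lemma den_ge0 v : 0 <= den v.
Proof. by rewrite addr_ge0 ?sqr_ge0. Qed.

Lemma measurable_den_inv : measurable_fun setT (fun v => (den v)^-1).
Proof.
(* At the pole v = u the inverse and the power -1 both have the value 0. *)
under eq_fun do rewrite -powR_inv1 ?den_ge0//.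
apply: (measurableT_comp (f := @powR R ^~ (-1)) (g := den)); first exact: measurable_powR.
by apply: measurable_funD; apply: measurable_funX; apply: measurable_funB.
Qed.

Lemma measurable_kernel_Re :
  measurable_fun setT (fun v => complex.Re (cauchy_kernel u v)).
Proof.
under eq_fun do rewrite cauchy_kernel_Re.
by apply: measurable_funM measurable_den_inv; exact: measurable_funB.
Qed.

Lemma measurable_kernel_Im :
  measurable_fun setT (fun v => complex.Im (cauchy_kernel u v)).
Proof.
under eq_fun do rewrite cauchy_kernel_Im.
by apply: measurable_funM measurable_den_inv; exact: measurable_funB.
Qed.

Variable (M : R).
Hypotheses (M_gt0 : 0 < M) (u_gt : M < nc u).
Local Notation ret := (segment_retract M).

Lemma normc_segment_dist v : nc u - M <= nc (u - complex_of_plane (ret v)).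
Proof.
apply: le_trans (normcB_ge _ _); rewrite lerD2l lerN2.
have -> : complex_of_plane (ret v) = (ret v).1%:C by [].
have /andP[? ?] := segment_retract_bound M_gt0 v.
by rewrite normc_real ger0_norm.
Qed.

Lemma den_retract_neq0 v : den (ret v) != 0.
Proof.
have : 0 < nc (u - complex_of_plane (ret v)).
  by apply: lt_le_trans (normc_segment_dist v); rewrite subr_gt0.
apply: contraTneq; rewrite -leNgt /den; case: (u) => p q /= ->.
by rewrite sqrtr0.
Qed.

Lemma continuous_retract_den_inv : continuous (fun v => (den (ret v))^-1).
Proof.
move=> v; apply: cvgV; first exact: den_retract_neq0.
have h : (complex.Re u - (ret w).1) @[w --> v] --> complex.Re u - (ret v).1.
  by apply: cvgB; [exact: cvg_cst | exact: continuous_retract_fst].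
exact: (cvgD (cvgM h h) (cvg_cst _)).
Qed.

Lemma continuous_kernel_Re :
  continuous ((fun v => complex.Re (cauchy_kernel u v)) \o ret).
Proof.
have -> : (fun v => complex.Re (cauchy_kernel u v)) \o ret =
    fun v => (complex.Re u - (ret v).1) / den (ret v).
  by apply/funext => v /=; rewrite cauchy_kernel_Re.
move=> v; apply: cvgM; last exact: continuous_retract_den_inv.
by apply: cvgB; [exact: cvg_cst | exact: continuous_retract_fst].
Qed.

Lemma continuous_kernel_Im :
  continuous ((fun v => complex.Im (cauchy_kernel u v)) \o ret).
Proof.
have -> : (fun v => complex.Im (cauchy_kernel u v)) \o ret =
    fun v => (0 - complex.Im u) / den (ret v).
  by apply/funext => v /=; rewrite cauchy_kernel_Im.
by move=> v; apply: cvgM; [exact: cvg_cst | exact: continuous_retract_den_inv].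
Qed.

Lemma normc_kernel v : nc (cauchy_kernel u (ret v)) <= (nc u - M)^-1.
Proof.
have uM : 0 < nc u - M by rewrite subr_gt0.
rewrite /cauchy_kernel ComplexField.Normc.normcV lef_pV2 ?posrE//; first exact: normc_segment_dist.
exact: lt_le_trans (normc_segment_dist v).
Qed.

Lemma kernel_Re_le v : `|complex.Re (cauchy_kernel u (ret v))| <= (nc u - M)^-1.
Proof.
apply: le_trans (normc_kernel v).
by rewrite -lecR -normc_norm; exact: normc_ge_Re.
Qed.

Lemma kernel_Im_le v : `|complex.Im (cauchy_kernel u (ret v))| <= (nc u - M)^-1.
Proof.
apply: le_trans (normc_kernel v).
by case: (cauchy_kernel _ _) => a b /=; rewrite -sqrtr_sqr ler_wsqrtr// lerDr sqr_ge0.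
Qed.

End CauchyTransform.

Section CauchyTransformLimit.
Variables (R : realType).
Local Notation nc := (@ComplexField.Normc.normc R).
Local Notation C := (real_complex R).

Lemma sum_complexE (I : Type) (s : seq I) (f : I -> R[i]) :
  \sum_(i <- s) f i =
  (\sum_(i <- s) complex.Re (f i)) +i* (\sum_(i <- s) complex.Im (f i)).
Proof.
elim: s => [|i s IH]; first by rewrite !big_nil.
by rewrite !big_cons IH; case: (f i).
Qed.

Lemma sum_inv_avg (u : R[i]) (s : seq R) (k : R) : 0 < k -> (size s)%:R = k ->
  sum_inv (map C s) (k%:C * u) =
  avg (map (fun z => z / k) s) (fun v => complex.Re (cauchy_kernel u (v, 0))) +i*
  avg (map (fun z => z / k) s) (fun v => complex.Im (cauchy_kernel u (v, 0))).
Proof.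
move=> k0 sk; rewrite /sum_inv big_map /avg size_map sk !big_map.
have -> : \sum_(z <- s) (k%:C * u - z%:C)^-1 =
    (k^-1)%:C * \sum_(z <- s) cauchy_kernel u (z / k, 0).
  rewrite mulr_sumr; apply: eq_bigr => z _; rewrite /cauchy_kernel.
  have -> : complex_of_plane (z / k, 0) = (z / k)%:C by [].
  rewrite fmorphV rmorphM fmorphV -invfM; congr _^-1; field.
  by rewrite fmorph_eq0 gt_eqF.
by rewrite sum_complexE; simpc.
Qed.

Lemma normc_le_ReIm (p q : R) : nc (p +i* q) <= `|p| + `|q|.
Proof.
rewrite -[leRHS]ger0_norm ?addr_ge0// -sqrtr_sqr /= ler_wsqrtr//.
by rewrite sqrrD !real_normK ?num_real// addrAC lerDl mulrn_wge0// mulr_ge0.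
Qed.

Lemma normc_cvg0 (F : set_system nat) (p q : nat -> R) (x y : R) : Filter F ->
  p @ F --> x -> q @ F --> y ->
  (fun m => nc ((p m +i* q m) - (x +i* y))) @ F --> (0 : R).
Proof.
move=> FF px qy.
apply: (@squeeze_cvgr _ _ _ _ (cst 0) (fun m => `|p m - x| + `|q m - y|)).
- by apply: nearW => m; rewrite normc_ge0; exact: normc_le_ReIm.
- exact: cvg_cst.
rewrite -[X in _ --> X](addr0 (0 : R)); apply: cvgD.
  rewrite -[X in _ --> X](@normr0 R R) -(subrr x).
  by apply: cvg_norm; apply: cvgB => //; exact: cvg_cst.
rewrite -[X in _ --> X](@normr0 R R) -(subrr y).
by apply: cvg_norm; apply: cvgB => //; exact: cvg_cst.
Qed.

(** Write d_j = c_j u - (y + A) and S for the sum of the theta_j / d_j. Multiplying the equation for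
    l by u and replacing c_j u by d_j + y + A gives y = 1 + (y + A) S, which is the claim before
    division by y - 1. *)
Lemma cauchy_transform_equation r (theta c : 'I_r -> R) (A : R) (u l : R[i]) :
  let y := u * l in
  (forall j, 0 < theta j) -> \sum_(j < r) theta j = 1 -> 0 <= A ->
  (forall j, 0 < c j) ->
  (forall j, 1 + A < nc ((c j)%:C * u - (y + A%:C))) ->
  l = \sum_(j < r) (theta j)%:C * (c j)%:C / ((c j)%:C * u - (y + A%:C)) ->
  [/\ y - 1 != 0,
      forall j, (c j)%:C * u - (y + A%:C) != 0 &
      (y + A%:C) / (y - 1) *
        \sum_(j < r) ((theta j)%:C / ((c j)%:C * u - (y + A%:C))) = 1].
Proof.
move=> y theta0 theta1 A0 c0 d_gt lE.
pose d j := (c j)%:C * u - (y + A%:C); pose S := \sum_(j < r) (theta j)%:C / d j.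
have tA : 0 < 1 + A by lra.
have d0 j : d j != 0 by apply: normc_gt0_neq0; exact: lt_trans (d_gt j).
have c_neq0 j : (c j)%:C != 0 by rewrite fmorph_eq0 gt_eqF.
have yS : y - 1 = (y + A%:C) * S.
  apply/eqP; rewrite subr_eq; apply/eqP.
  rewrite -[X in _ + X](rmorph1 C) -theta1 rmorph_sum mulr_sumr -big_split /=.
  rewrite {1}/y lE mulr_sumr; apply: eq_bigr => j _; rewrite -/(d j).
  have -> : y + A%:C = (c j)%:C * u - d j by rewrite /d; ring.
  by field.
have y1 : y - 1 != 0.
  (* If y = 1 then S = 0, because 1 + A > 0. Expanding u S = 0 with c_j u = d_j + 1 + A shows that
     the sum of the e_j equals -(1 + A) times the sum of the e_j / d_j, which is impossible when all
     |d_j| > 1 + A. *)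
  apply/negP => /eqP y10; pose e j := theta j / c j.
  have e0 j : 0 < e j by rewrite divr_gt0.
  have S0 : S = 0.
    move: yS; rewrite y10 => /esym/eqP; rewrite mulf_eq0 => /orP[|/eqP//].
    move/subr0_eq: y10 => ->; rewrite -(rmorph1 C) -rmorphD fmorph_eq0.
    by rewrite gt_eqF.
  have eE : (\sum_(j < r) e j)%:C = - ((1 + A)%:C * \sum_(j < r) (e j)%:C / d j).
    apply/eqP; rewrite -addr_eq0 mulr_sumr rmorph_sum -big_split /=; apply/eqP.
    have uS : u * S = 0 by rewrite S0 mulr0.
    rewrite -[RHS]uS /S mulr_sumr; apply: eq_bigr => j _.
    have -> : (1 + A)%:C = (c j)%:C * u - d j.
      by rewrite /d (subr0_eq y10) rmorphD rmorph1; ring.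
    by rewrite /e rmorphM fmorphV; field; rewrite d0 c_neq0.
  have : \sum_(j < r) e j <= \sum_(j < r) e j * ((1 + A) / nc (d j)).
    have <- : nc (\sum_(j < r) e j)%:C = \sum_(j < r) e j.
      by rewrite normc_real ger0_norm// sumr_ge0// => j _; exact: ltW.
    rewrite eE normcN mulr_sumr; apply: (le_trans (le_normc_sum _ _)).
    apply: ler_sum => j _; rewrite !ComplexField.Normc.normcM.
    rewrite ComplexField.Normc.normcV !normc_real !gtr0_norm//.
    by rewrite mulrCA.
  apply/negP; rewrite -ltNge -subr_gt0 -sumrB.
  have [j _|r0] := pickP (fun _ : 'I_r => true); last first.
    by move: theta1; rewrite big1 => [/eqP|i _]; [rewrite eq_sym oner_eq0 | have := r0 i].
  have tj i : 0 < e i - e i * ((1 + A) / nc (d i)).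
    rewrite subr_gt0 gtr_pMr// ltr_pdivrMr ?mul1r//; first exact: d_gt.
    exact: lt_trans (d_gt i).
  rewrite (bigD1 j)//= ltr_wpDr// sumr_ge0// => i _; exact: ltW.
by split => //; rewrite -/S mulrAC -yS mulfV.
Qed.

End CauchyTransformLimit.

Theorem theorem5p12 (R : realType) (r : nat)
    (n : nat -> 'I_r -> nat) (alpha : nat -> R) (c_ : nat -> 'I_r -> R)
    (A : R) (theta c : 'I_r -> R) (L : nat -> {poly R})
    (n_gt0 : forall m i, (0 < n m i)%N)
    (n_oo : (fun m => msize (n m)) @ \oo --> \oo)
    (alpha_gtN1 : forall m, -1 < alpha m)
    (A_ge0 : 0 <= A)
    (alpha_cvg : (fun m => alpha m / (msize (n m))%:R) @ \oo --> A)
    (theta_gt0 : forall i, 0 < theta i)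
    (theta_cvg : forall i,
       (fun m => (n m i)%:R / (msize (n m))%:R) @ \oo --> theta i)
    (c__gt0 : forall m i, 0 < c_ m i)
    (c__neq : forall m i j, i != j -> c_ m i != c_ m j)
    (c_gt0 : forall i, 0 < c i)
    (c_neq : forall i j, i != j -> c i != c j)
    (c_cvg : forall i, (fun m => c_ m i) @ \oo --> c i)
    (L_laguerre : forall m,
       is_multiple_laguerre2 (alpha m) (c_ m) (n m) (L m)) :
  let rescaled m := L m \Po ((msize (n m))%:R *: 'X) in
  (exists mu : probability (R * R)%type R,
     is_limiting_zero_distribution rescaled mu) /\
  (forall mu : probability (R * R)%type R,
     is_limiting_zero_distribution rescaled mu ->
     exists M : R, forall u : R[i], M%:C < `|u| ->
       cauchy_integrable mu u /\
       let y := u * cauchy_transform mu u in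
       [/\ y - 1 != 0,
           forall j, (c j)%:C * u - (y + A%:C) != 0 &
           (y + A%:C) / (y - 1) *
             \sum_(j < r) ((theta j)%:C / ((c j)%:C * u - (y + A%:C))) = 1]).
Proof.
have [zs zsE] := zeros_exist n_gt0 n_oo alpha_gtN1 c__gt0.
have [ws wsE] := rem_zeros_exist n_gt0 n_oo alpha_gtN1 c__gt0.
pose N m := msize (n m).
have N0 m : 0 < (N m)%:R :> R by rewrite ltr0n; exact: msize_gt0.
pose vs m := map (fun z => z / (N m)%:R) (zs m).
have LE m : L m = prod_roots (zs m).
  by rewrite -zsE; apply: multiple_laguerre2E (L_laguerre m) => // i j; exact: c__neq.
move=> rescaled.
have avgE m (f : R * R -> R) : continuous f ->
    (\int[zero_counting (rescaled m)]_z f z)%R = avg (vs m) (fun v => f (v, 0)).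
  have Nm : (N m)%:R != 0 :> R by rewrite gt_eqF.
  move=> cf; rewrite /rescaled LE prod_roots_rescale//.
  by rewrite Rintegral_zero_counting// expf_neq0.
have lim_avg (mu : probability (R * R)%type R) : is_limiting_zero_distribution rescaled mu <->
    forall f : R * R -> R, continuous f -> (exists B : R, forall z, `|f z| <= B) ->
      avg (vs m) (fun v => f (v, 0)) @[m --> \oo] --> (\int[mu]_z f z)%R.
  split => h f cf bf; have := h f cf bf.
    by have -> : (fun m => (\int[zero_counting (rescaled m)]_z f z)%R) =
      (fun m => avg (vs m) (fun v => f (v, 0))) by apply/funext => m; exact: avgE.
  by have -> : (fun m => (\int[zero_counting (rescaled m)]_z f z)%R) =
    (fun m => avg (vs m) (fun v => f (v, 0))) by apply/funext => m; exact: avgE.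
split.
  have [nu nuE] := weak_limit n_gt0 n_oo alpha_gtN1 A_ge0 alpha_cvg theta_gt0
    theta_cvg c__gt0 c_gt0 c_cvg zsE wsE.
  by exists nu; apply/lim_avg.
move=> mu /lim_avg mu_lim; set M0 := zero_bound A c.
have M00 : 0 < M0 by exact: zero_bound_gt0.
exists (2 * M0) => u; rewrite normc_norm ltcR => u_gt.
have uM : M0 < ComplexField.Normc.normc u by lra.
have vsb := vs_bound n_gt0 n_oo alpha_gtN1 alpha_cvg c__gt0 c_gt0 c_cvg zsE.
have [iRe lRe] := segment_transfer vsb mu_lim (@measurable_kernel_Re R u)
  (continuous_kernel_Re M00 uM) (kernel_Re_le M00 uM).
have [iIm lIm] := segment_transfer vsb mu_lim (@measurable_kernel_Im R u)
  (continuous_kernel_Im M00 uM) (kernel_Im_le M00 uM).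
split => //; set l := cauchy_transform mu u.
have szs m : size (zs m) = N m.
  by rewrite (size_lagp_roots (zsE m)) size_rate_seq.
have [|ul lE] := limit_equation n_gt0 n_oo alpha_gtN1 A_ge0 alpha_cvg
    theta_cvg c__gt0 c_gt0 c_cvg zsE wsE u_gt _ (@subset_refl _ \oo) (l := l).
  apply: (cvg_trans _ (normc_cvg0 _ lRe lIm)); apply: near_eq_cvg.
  apply: nearW => m; rewrite -(rmorph_nat (real_complex R)).
  by rewrite (sum_inv_avg u (N0 m)) ?szs.
have dE j : (c j)%:C * u - (u * l + A%:C) = (c j)%:C * limit_denominator A c u j l.
  rewrite /limit_denominator fmorphV; field.
  by rewrite fmorph_eq0 gt_eqF.
apply: cauchy_transform_equation => //.
- exact: sum_theta.
(* The modulus is at least c_j |u| / 2 > c_j M0, and c_j M0 >= 2 (A + 4) > 1 + A because c_j times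
   [rate_bound c] is at least 1. *)
- move=> j; rewrite dE ComplexField.Normc.normcM normc_real gtr0_norm//.
  have h := limit_denominator_ge A_ge0 c_gt0 u_gt j ul.
  have cj : 1 <= c j * rate_bound c.
    by rewrite mulrC -ler_pdivrMr// div1r; exact: ltW (rate_bound_gt c_gt0 j).
  have : c j * (ComplexField.Normc.normc u / 2) <=
      c j * ComplexField.Normc.normc (limit_denominator A c u j l) by rewrite ler_pM2l.
  apply: lt_le_trans; apply: (@lt_trans _ _ (c j * M0)); last first.
    by rewrite ltr_pM2l//; lra.
  rewrite /M0 /zero_bound.
  have := ler_wpM2r (_ : 0 <= 2 * (A + 2 + 2)) cj.
  have : 0 <= 2 * (A + 2 + 2) by lra.
  move=> h1 /(_ h1); lra.
rewrite {1}lE; apply: eq_bigr => j _; rewrite dE invfM.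
have cj : (c j)%:C != 0 :> R[i] by rewrite fmorph_eq0 gt_eqF.
have := limit_denominator_neq0 A_ge0 c_gt0 u_gt j ul => d0.
by field; rewrite cj d0.
Qed.
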